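(* For every $A=(a_{ij})\in\Xi_d$ one has in $\mathbf S^{\jmath}$ $$\prod_{1\le j\le h<i\le N}\big[D_{i,h,j}+a_{ij}E^\theta_{h+1,h}\big]=[A]+\text{lower terms},$$ where ''lower terms'' is an $\mathcal A$-linear combination of elements $[A']$ with $A'\sqsubset A$; the product (with respect to $*$) is taken from left to right in the following order of the index triples: $(i,h,j)$ precedes $(i',h',j')$ if and only if $i<i'$, or $i=i'$ and $j<j'$, or $i=i'$, $j=j'$ and $h>h'$; and the $D_{i,h,j}$ are diagonal $N\times N$ matrices over $\mathbb N$ which are uniquely determined by the requirements that the factors lie in $\Xi_d$, that the column-sum vector of each factor equals the row-sum vector of the next factor, that the first factor has row-sum vector $\mathrm{ro}(A)$, and that the last factor has column-sum vector $\mathrm{co}(A)$. Moreover, the product has $\frac{N(N^2-1)}6$ factors.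
   Context: Let $\mathcal A=\mathbb Z[v,v^{-1}]$, $n,d\ge1$, $N=2n+1$, $D=2d+1$; $\mathbb N=\{0,1,2,\dots\}$, and $|U|=\dim U$. For an odd prime power $q$ equip $\mathbb F_q^D$ with a nondegenerate symmetric bilinear form with isometry group $O(D)$, and let $X$ be the set of flags $V=(0=V_0\subseteq V_1\subseteq\cdots\subseteq V_N=\mathbb F_q^D)$ with $V_i=V_{N-i}^\perp$ for all $i$. Let $\Xi_d$ be the set of $N\times N$ matrices $A=(a_{ij})$ over $\mathbb N$ with $\sum a_{ij}=D$ and $a_{ij}=a_{N+1-i,N+1-j}$. The $O(D)$-orbits $\mathcal O_A$ on $X\times X$ are indexed by $A\in\Xi_d$: $(V,V')\in\mathcal O_A$ iff $a_{ij}=|(V_{i-1}+V_i\cap V'_j)/(V_{i-1}+V_i\cap V'_{j-1})|$ for all $i,j$. $\mathbf S^{\jmath}$ is the free $\mathcal A$-module with basis $e_A$ ($A\in\Xi_d$), $e_A$ being the characteristic function of $\mathcal O_A$, with product $e_A*e_{A'}=\sum_{A''}g_{A,A',A''}e_{A''}$, where $g_{A,A',A''}\in\mathbb Z[v^2]$ is the polynomial whose value at $v=\sqrt q$, for every odd prime power $q$, is the number of $V\in X$ with $(V_1,V)\in\mathcal O_A$, $(V,V_2)\in\mathcal O_{A'}$, for any fixed $(V_1,V_2)\in\mathcal O_{A''}$. Standard basis: $[A]=v^{-d_A}e_A$, where $d_A$ is the dimension (over $\overline{\mathbb F}_q$) of $\mathcal O_A$ minus the dimension of its image under the first projection $X\times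 X\to X$; explicitly $$d_A=\sum_{i>k,\,j<l,\,i+k<N+1}a_{ij}a_{kl}+\sum_{j<l,\ (i<n+1\text{ or }j<N+1-l)}a_{ij}a_{il}+\sum_{i\ge n+1>j}\frac{a_{ij}(a_{ij}-1)}2 .$$ $\mathrm{ro}(A)$, $\mathrm{co}(A)$ are the vectors of row sums and column sums of $A$. $E_{ij}$ is the elementary matrix and $E^\theta_{ij}=E_{ij}+E_{N+1-i,N+1-j}$. Partial order on $\Xi_d$: $A'\sqsubseteq A$ iff $\mathrm{ro}(A')=\mathrm{ro}(A)$, $\mathrm{co}(A')=\mathrm{co}(A)$, $\sum_{r\le i,s\ge j}a'_{rs}\le\sum_{r\le i,s\ge j}a_{rs}$ for all $i<j$, and $\sum_{r\ge i,s\le j}a'_{rs}\le\sum_{r\ge i,s\le j}a_{rs}$ for all $i>j$; $A'\sqsubset A$ means $A'\sqsubseteq A$ and $A'\ne A$. *)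

(* Defs.v *)
From HB Require Import structures.
From mathcomp Require Import all_boot all_order all_algebra.
From mathcomp Require Import boolp classical_sets.

Set Implicit Arguments.
Unset Strict Implicit.
Unset Printing Implicit Defensive.

Import GRing.Theory.
Local Open Scope ring_scope.

(* Z[v, v^-1] is the subring of the fraction field of Z[v] consisting of the *)
(* fractions whose denominator is a power of v.                              *)
Notation ratfrac := {fraction {poly int}}.

Definition laurent_pred : {pred ratfrac} :=
  fun x => `[< exists (p : {poly int}) (k : nat),
                 x = tofrac p / tofrac 'X ^+ k >].

Fact laurent_pred_subring : subring_closed laurent_pred.
Proof.
have X0 k : tofrac ('X : {poly int}) ^+ k != 0.
  by rewrite expf_neq0 // tofrac_eq0 polyX_eq0.
split=> [|x y /asboolP[p [k ->]] /asboolP[r [l ->]]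
         |x y /asboolP[p [k ->]] /asboolP[r [l ->]]]; apply/asboolP.
- by exists 1, 0%N; rewrite expr0 divr1 tofrac1.
- exists (p * 'X ^+ l - r * 'X ^+ k), (k + l)%N.
  rewrite -mulNr addf_div // !rmorphB !rmorphM /= !rmorphXn exprD mulNr.
  by [].
- exists (p * r), (k + l)%N.
  by rewrite mulf_div rmorphM exprD.
Qed.

HB.instance Definition _ :=
  GRing.isSubringClosed.Build _ laurent_pred laurent_pred_subring.

Record laurent := Laurent {
  laurent_val :> ratfrac;
  laurentP : laurent_val \in laurent_pred }.

HB.instance Definition _ := [isSub for laurent_val].
HB.instance Definition _ := [Choice of laurent by <:].
HB.instance Definition _ := [SubChoice_isSubComNzRing of laurent by <:].

Fact v_laurent : tofrac ('X : {poly int}) \in laurent_pred.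
Proof. by apply/asboolP; exists 'X, 0%N; rewrite expr0 divr1. Qed.

Fact vinv_laurent : (tofrac ('X : {poly int}))^-1 \in laurent_pred.
Proof. by apply/asboolP; exists 1, 1%N; rewrite expr1 tofrac1 div1r. Qed.

Definition v : laurent := Laurent v_laurent.
Definition vinv : laurent := Laurent vinv_laurent.

(* Substitution t := v^2, from Z[t] to Z[v, v^-1]. *)
Definition at_vsqr (g : {poly int}) : laurent := (map_poly intr g).[v ^+ 2].

Notation dimN n := (2 * n).+1 (only parsing).
Notation dimD d := (2 * d).+1 (only parsing).

(* Rows and columns are numbered from 0: the usual a_{ij} is the entry of    *)
(* index (i-1, j-1), and i |-> N+1-i becomes rev_ord.                        *)

Definition Xi_pred (n d : nat) : pred 'M[nat]_(dimN n) := fun A =>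
  (\sum_i \sum_j A i j == dimD d)%N &&
  [forall i, forall j, A i j == A (rev_ord i) (rev_ord j)].

Record Xi (n d : nat) := MkXi {
  Xi_mx :> 'M[nat]_(dimN n);
  XiP : Xi_pred d Xi_mx }.

HB.instance Definition _ n d := [isSub for @Xi_mx n d].
HB.instance Definition _ n d := [Countable of Xi n d by <:].

Section XiFinite.
Variables n d : nat.

Fact Xi_entry_le (A : Xi n d) i j : (A i j < (dimD d).+1)%N.
Proof.
case/andP: (XiP A) => /eqP <- _; rewrite ltnS.
rewrite (bigD1 i) //= (bigD1 j) //= -addnA; exact: leq_addr.
Qed.

Definition Xi_code (A : Xi n d) : 'M['I_(dimD d).+1]_(dimN n) :=
  \matrix_(i, j) Ordinal (Xi_entry_le A i j).

Definition Xi_decode (M : 'M['I_(dimD d).+1]_(dimN n)) : option (Xi n d) :=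
  insub (map_mx (@nat_of_ord _) M).

Fact Xi_codeK : pcancel Xi_code Xi_decode.
Proof.
move=> A; rewrite /Xi_decode -[RHS](valK A); congr (insub _).
by apply/matrixP=> i j; rewrite !mxE.
Qed.

HB.instance Definition _ : isFinite (Xi n d) := PCanIsFinite Xi_codeK.

End XiFinite.

Definition ro N (A : 'M[nat]_N) : 'rV[nat]_N := \row_i (\sum_j A i j)%N.
Definition co N (A : 'M[nat]_N) : 'rV[nat]_N := \row_j (\sum_i A i j)%N.

Definition Etheta N (i j : 'I_N) : 'M[nat]_N :=
  delta_mx i j + delta_mx (rev_ord i) (rev_ord j).

Definition Xi_le N (A' A : 'M[nat]_N) : bool :=
  [&& ro A' == ro A, co A' == co A,
      [forall i : 'I_N, forall j : 'I_N, (i < j)%N ==>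
         (\sum_(r < N | r <= i) \sum_(s < N | s >= j) A' r s <=
          \sum_(r < N | r <= i) \sum_(s < N | s >= j) A r s)%N]
    & [forall i : 'I_N, forall j : 'I_N, (i > j)%N ==>
         (\sum_(r < N | r >= i) \sum_(s < N | s <= j) A' r s <=
          \sum_(r < N | r >= i) \sum_(s < N | s <= j) A r s)%N]].

Definition Xi_lt N (A' A : 'M[nat]_N) : bool := Xi_le A' A && (A' != A).

(* With 0-based indices, i + k < N + 1 reads i + k < 2n, i < n + 1 reads     *)
(* i < n, j < N + 1 - l reads j + l < 2n, and i >= n + 1 > j reads           *)
(* i >= n > j.                                                               *)
Definition dstd n (A : 'M[nat]_(dimN n)) : nat :=
  (\sum_(i : 'I_(dimN n)) \sum_(k : 'I_(dimN n) | (k < i) && (i + k < 2 * n))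
      \sum_(j : 'I_(dimN n)) \sum_(l : 'I_(dimN n) | j < l) A i j * A k l
   + \sum_(i : 'I_(dimN n)) \sum_(j : 'I_(dimN n))
      \sum_(l : 'I_(dimN n) | (j < l) && ((i < n) || (j + l < 2 * n)))
        A i j * A i l
   + \sum_(i : 'I_(dimN n) | n <= i) \sum_(j : 'I_(dimN n) | j < n)
      (A i j * (A i j - 1)) %/ 2)%N.

Section VspaceFinite.
Variables (F : finFieldType) (vT : vectType F).

Let vs2mxK : cancel (@VectorInternalTheory.vs2mx F vT) _ :=
  @VectorInternalTheory.vs2mxK F vT.

HB.instance Definition _ : isCountable {vspace vT} :=
  CanIsCountable vs2mxK.
HB.instance Definition _ : isFinite {vspace vT} := CanIsFinite vs2mxK.

End VspaceFinite.

Section Flags.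
Variables (n d : nat) (F : finFieldType).

Notation space := {vspace 'rV[F]_(dimD d)}.
(* V i is V_i for 0 <= i <= N. *)
Notation flag := {ffun 'I_(dimN n).+1 -> space}.

Definition isflag (b : {symmetric 'rV[F]_(dimD d)}) (V : flag) : bool :=
  [&& V ord0 == 0%VS, V ord_max == fullv,
      [forall i : 'I_(dimN n).+1, forall j : 'I_(dimN n).+1,
         (i <= j)%N ==> (V i <= V j)%VS]
    & [forall i, V i == orthov b (V (rev_ord i))]].

(* The subtraction is exact: the second space is contained in the first.     *)
Definition relpos (V V' : flag) : 'M[nat]_(dimN n) := \matrix_(i, j)
  (\dim (V (inord i) + V (inord i.+1) :&: V' (inord j.+1))%VS
   - \dim (V (inord i) + V (inord i.+1) :&: V' (inord j))%VS)%N.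

Definition mid_flags b (A A' : Xi n d) (V1 V2 : flag) : {set flag} :=
  [set V | [&& isflag b V, relpos V1 V == A & relpos V V2 == A']].

End Flags.

Section Algebra.
Variables n d : nat.

(* g is a polynomial in t = v^2; finite fields of odd order realize exactly  *)
(* the odd prime powers q.                                                   *)
Definition is_hall (A A' A'' : Xi n d) (g : {poly int}) : Prop :=
  forall (F : finFieldType) (b : {symmetric 'rV[F]_(dimD d)})
         (V1 V2 : {ffun 'I_(dimN n).+1 -> {vspace 'rV[F]_(dimD d)}}),
    odd #|F| -> nondegenerate b ->
    isflag b V1 -> isflag b V2 -> relpos V1 V2 = A'' ->
    g.[#|F|%:Z] = #|mid_flags b A A' V1 V2|%:Z.

(* Such a g exists (as a polynomial not depending on F and b) and is unique, *)
(* so the default value 0 of xget is never used.                             *)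
Definition hall (A A' A'' : Xi n d) : {poly int} :=
  xget 0 [set g | is_hall A A' A'' g]%classic.

Definition Sj := {ffun Xi n d -> laurent^o}.

Definition ebasis (A : Xi n d) : Sj := [ffun B => (B == A)%:R].

Definition Sj_mul (f g : Sj) : Sj :=
  \sum_A \sum_A' (f A * g A' : laurent) *:
    \sum_A'' at_vsqr (hall A A' A'') *: ebasis A''.

Definition std (A : Xi n d) : Sj := vinv ^+ dstd A *: ebasis A.

(* The product of a nonempty sequence, bracketed from the left.              *)
Definition Sj_prod (s : seq Sj) : Sj :=
  if s is x :: s' then foldl Sj_mul x s' else 0.

End Algebra.

(* Triples (i, h, j), in this order. *)
Record triple N := Triple {
  tr_ihj : 'I_N * 'I_N * 'I_N;
  tripleP : (tr_ihj.2 <= tr_ihj.1.2 < tr_ihj.1.1)%N }.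

HB.instance Definition _ N := [isSub for @tr_ihj N].
HB.instance Definition _ N := [Finite of triple N by <:].

Definition tr_i N (t : triple N) : 'I_N := (tr_ihj t).1.1.
Definition tr_h N (t : triple N) : 'I_N := (tr_ihj t).1.2.
Definition tr_j N (t : triple N) : 'I_N := (tr_ihj t).2.

Definition precedes N (t t' : triple N) : bool :=
  [|| (tr_i t < tr_i t')%N,
      (tr_i t == tr_i t') && (tr_j t < tr_j t')%N
    | [&& tr_i t == tr_i t', tr_j t == tr_j t' & (tr_h t > tr_h t')%N]].

Definition triples N : seq (triple N) :=
  sort (fun t t' => (t == t') || precedes t t') (enum {: triple N}).

Section Factors.
Variables n d : nat.
Let N := dimN n.

(* D + a_{ij} E^theta_{h+1,h}; here h < i, so h + 1 is an index. *)
Definition factor (A D : 'M[nat]_N) (t : triple N) : 'M[nat]_N :=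
  D + Etheta (inord (tr_h t).+1) (tr_h t) *+ A (tr_i t) (tr_j t).

Definition factorization (A : Xi n d) (D : {ffun triple N -> 'M[nat]_N})
    (B : triple N -> Xi n d) : Prop :=
  let Bs := [seq (B t : 'M[nat]_N) | t <- triples N] in
  [/\ forall t, is_diag_mx (D t),
      forall t, B t = factor A (D t) t :> 'M[nat]_N,
      sorted (fun M M' => co M == ro M') Bs,
      ohead [seq ro M | M <- Bs] = Some (ro A)
    & ohead (rev [seq co M | M <- Bs]) = Some (co A)].

End Factors.

(* Main.v *)
Require Import Defs.
From HB Require Import structures.
From mathcomp Require Import all_boot all_order all_algebra zify.
From mathcomp Require boolp classical_sets.

(* Write f_M(s, t) for the sum of the entries of M in its first s rows and     *)
(* first t columns.  If M is the relative position of V and V', then f_M(s, t) *)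
(* is the dimension of the intersection of V_s and V'_t; since the two corner  *)
(* sums defining the partial order are dim V_s - f_M(s, t) and                 *)
(* dim V'_t - f_M(s, t), a smaller matrix is one with the same row and column  *)
(* sums and a pointwise larger f_M.                                            *)
(*                                                                             *)
(* Right multiplication by D + r E^theta_{h+1,h} enlarges V_h by r dimensions  *)
(* inside V_{h+1} (and changes V_{N-h} dually).  At the step (i, h, j) the     *)
(* partial product has a leading matrix C whose rows below i vanish in the     *)
(* columns up to h+1 and whose entry (i, h) is 0; moving r = a_{ij} units of   *)
(* row i from column h+1 to column h gives the next leading matrix C'.  If     *)
(* (V1, V2) has position C', the only possible middle flag has h-th space      *)
(* V2_{h-1} + (V2_h cap V1_{i-1}), so e_{C'} occurs with coefficient 1; and    *)
(* comparing dimensions of intersections shows that everything else is lower.  *)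
(* Finally 2 d_A + sum_{i >= n+1 > j} a_{ij} is the quadratic form             *)
(* sum_{i >= k, j < l} a_{ij} a_{kl}, which yields d_{C'} = d_C + d_B for the  *)
(* factor B, so the powers of v match.                                         *)

Set Implicit Arguments.
Unset Strict Implicit.
Unset Printing Implicit Defensive.

Import GRing.Theory.
Local Open Scope ring_scope.

(** * Prefix sums and relative positions of flags *)

(** The product is multiplied out from the left under the invariant [leading f C]: the coefficient
    of e_C in f is v^{-d_C}, and every e_X that occurs has X below or equal to C. The leading matrix
    starts out diagonal. The strictly lower part of A is then built row by row from the top and,
    within a row, from left to right: a_{ij} is carried from the diagonal to column j, one column
    per factor. Rotation symmetry and the row sums determine the rest ([eq_of_lower]), so the last
    leading matrix is A.

    One factor is handled by [leading_mul], which rests on three facts. Triangularity is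
    [Xi_le_raised]: dimensions of intersections bound every position that occurs by the new leading
    matrix, which itself arises only from the old one. The leading count is 1 by [card_mid_flags].
    Degrees add up by [raising_dstd]: the change of d under a move depends only on h, on r and on
    the sum of column h+1. Hence it is the same for the leading matrix and for the diagonal matrix
    with the same column sums from which the factor arises, and that diagonal matrix has degree 0.

    The structure constants are accessible only through their values at odd prime powers. By
    [realization] every matrix of Xi is a relative position over every finite field. So a nonzero
    constant yields actual flags over some F_p ([hall_neq0]), and a count that is always 1 forces
    the constant 1 ([hall_eq1]).

    Uniqueness propagates along the chain ([factor_uniq_path]): the row sums of a factor fix its
    diagonal part, hence its column sums, hence the row sums of the next factor. *)

Section PrefixSums.
Variable N : nat.
Implicit Types A B : 'M[nat]_N.

Definition psum A (s t : nat) : nat :=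
  (\sum_(i < N | i < s) \sum_(j < N | j < t) A i j)%N.

Lemma sum_ord_ltnS (F : 'I_N -> nat) (i : 'I_N) :
  (\sum_(k < N | k < i.+1) F k = \sum_(k < N | k < i) F k + F i)%N.
Proof.
rewrite (bigD1 i) //= addnC; congr (_ + _)%N; apply: eq_bigl => k.
by rewrite ltnS ltn_neqAle andbC.
Qed.

Lemma psum0l A t : psum A 0 t = 0%N.
Proof. by rewrite /psum big_pred0. Qed.

Lemma psum0r A s : psum A s 0 = 0%N.
Proof. by rewrite /psum big1 // => i _; rewrite big_pred0. Qed.

Lemma psumSS A (i j : 'I_N) :
  (psum A i.+1 j.+1 + psum A i j = psum A i j.+1 + psum A i.+1 j + A i j)%N.
Proof.
have E t := sum_ord_ltnS (fun k => \sum_(l < N | l < t) A k l)%N i.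
have := E j; have := E j.+1; have := sum_ord_ltnS (A i) j; rewrite /psum; lia.
Qed.

(** A function on the grid is determined by its zero boundary values and its mixed second
    differences. This identifies prefix sums with dimensions of intersections. *)
Lemma psum_rect A (f : nat -> nat -> nat) :
    (forall t, f 0%N t = 0%N) -> (forall s, f s 0%N = 0%N) ->
    (forall i j : 'I_N,
       f i.+1 j.+1 + f i j = f i j.+1 + f i.+1 j + A i j)%N ->
  forall s t, (s <= N)%N -> (t <= N)%N -> psum A s t = f s t.
Proof.
move=> f0 f0' fS; elim=> [t _ _|s IHs]; first by rewrite psum0l f0.
elim=> [_ _|t IHt sN tN]; first by rewrite psum0r f0'.
have := psumSS A (Ordinal sN) (Ordinal tN).
have := fS (Ordinal sN) (Ordinal tN) => /=.
have := IHt sN (ltnW tN); have := IHs t.+1 (ltnW sN) tN.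
have := IHs t (ltnW sN) (ltnW tN); lia.
Qed.

Lemma psum_inj A B :
  (forall s t, (s <= N)%N -> (t <= N)%N -> psum A s t = psum B s t) -> A = B.
Proof.
move=> eqAB; apply/matrixP => i j.
have := psumSS A i j; have := psumSS B i j.
have := ltn_ord i; have := ltn_ord j => jN iN.
have iN' := ltnW iN; have jN' := ltnW jN.
by rewrite !eqAB //; lia.
Qed.

Lemma psumD A B s t : psum (A + B) s t = (psum A s t + psum B s t)%N.
Proof.
rewrite /psum -big_split; apply: eq_bigr => i _.
by rewrite -big_split; apply: eq_bigr => j _; rewrite mxE.
Qed.

Lemma psum_delta (i j : 'I_N) s t : psum (delta_mx i j) s t = ((i < s) && (j < t))%N.
Proof.
have E (F : 'I_N -> nat) (k : 'I_N) u :
    (\sum_(l < N | l < u) (l == k) * F l = (k < u) * F k)%N.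
  rewrite big_mkcond (bigD1 k) //= eqxx mul1n big1 ?addn0; first by case: (k < u)%N; rewrite ?mul1n.
  by move=> l /negPf->; rewrite mul0n if_same.
rewrite /psum (eq_bigr (fun k : 'I_N => ((k == i) * (j < t))%N)); last first.
  move=> k _; rewrite -[X in (_ * X)%N]muln1 -E big_distrr /=.
  by apply: eq_bigr => l _; rewrite mxE muln1 mulnb natn.
by rewrite E mulnb.
Qed.

Lemma psumMn A r s t : psum (A *+ r) s t = (psum A s t * r)%N.
Proof.
elim: r => [|r IHr]; last by rewrite mulrS psumD IHr mulnS.
by rewrite mulr0n muln0 /psum big1 // => i _; rewrite big1 // => j _; rewrite mxE.
Qed.

Lemma sum_ord_lt_full (F : 'I_N -> nat) : (\sum_(k < N | k < N) F k = \sum_k F k)%N.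
Proof. by apply: eq_bigl => k; rewrite ltn_ord. Qed.

Lemma psum_ro A s : psum A s N = (\sum_(i < N | i < s) ro A 0%R i)%N.
Proof. by apply: eq_bigr => i _; rewrite sum_ord_lt_full mxE. Qed.

Lemma psum_co A t : psum A N t = (\sum_(j < N | j < t) co A 0%R j)%N.
Proof.
rewrite /psum sum_ord_lt_full exchange_big /=.
by apply: eq_bigr => j _; rewrite mxE.
Qed.

Lemma ro_psum A B : ro A = ro B <-> (forall s, (s <= N)%N -> psum A s N = psum B s N).
Proof.
split=> [eqAB s _|eqAB]; first by rewrite !psum_ro eqAB.
apply/rowP => i; have := eqAB _ (ltn_ord i); have := eqAB _ (ltnW (ltn_ord i)).
rewrite !psum_ro !sum_ord_ltnS; lia.
Qed.

Lemma co_psum A B : co A = co B <-> (forall t, (t <= N)%N -> psum A N t = psum B N t).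
Proof.
split=> [eqAB s _|eqAB]; first by rewrite !psum_co eqAB.
apply/rowP => i; have := eqAB _ (ltn_ord i); have := eqAB _ (ltnW (ltn_ord i)).
rewrite !psum_co !sum_ord_ltnS; lia.
Qed.

Lemma psum_compl_col A s t : (t <= N)%N ->
  (\sum_(i < N | i < s) \sum_(j < N | t <= j) A i j + psum A s t = psum A s N)%N.
Proof.
move=> tN; rewrite /psum -big_split /=; apply: eq_bigr => i _.
rewrite sum_ord_lt_full [RHS](bigID (fun j : 'I_N => t <= j)%N) /=; congr (_ + _)%N.
by apply: eq_bigl => j; rewrite ltnNge.
Qed.

Lemma psum_compl_row A s t : (s <= N)%N ->
  (\sum_(i < N | s <= i) \sum_(j < N | j < t) A i j + psum A s t = psum A N t)%N.
Proof.
move=> sN; rewrite /psum sum_ord_lt_full [RHS](bigID (fun i : 'I_N => s <= i)%N) /=.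
by congr (_ + _)%N; apply: eq_bigl => j; rewrite ltnNge.
Qed.

(** With equal row and column sums, each corner sum is a fixed number minus a prefix sum, so the
    inequality reverses. *)
Lemma Xi_leP A B :
  reflect [/\ forall s, (s <= N)%N -> psum A s N = psum B s N,
              forall t, (t <= N)%N -> psum A N t = psum B N t
            & forall s t, (s <= N)%N -> (t <= N)%N -> (psum B s t <= psum A s t)%N]
          (Xi_le A B).
Proof.
apply: (iffP and4P) => [[/eqP/ro_psum eqr /eqP/co_psum eqc le1 le2]|[eqr eqc le]].
  split=> // s t sN tN; case: (posnP s) => [->|s0]; first by rewrite !psum0l.
  case: (posnP t) => [->|t0]; first by rewrite !psum0r.
  (* The upper right corner with i = s-1 and j = t covers s <= t; the lower left one with i = s and
     j = t-1 covers the rest. Where an index leaves the matrix, the equality of row or column sums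
     takes over. *)
  case: (leqP s t) => st.
    case: (leqP N t) => Nt.
      by have -> : t = N by [lia]; rewrite eqr.
    have s1N : (s.-1 < N)%N by lia.
    move/forallP/(_ (Ordinal s1N))/forallP/(_ (Ordinal Nt))/implyP: le1 => /=.
    have -> : (s.-1 < t)%N by lia.
    move=> /(_ isT).
    have E (M : 'M[nat]_N) : (\sum_(r < N | r <= s.-1) \sum_(c < N | t <= c) M r c =
       \sum_(r < N | r < s) \sum_(c < N | t <= c) M r c)%N.
      by apply: eq_bigl => r; lia.
    rewrite !E.
    have := psum_compl_col A s tN; have := psum_compl_col B s tN.
    have := eqr _ sN; lia.
  case: (leqP N s) => Ns.
    by have -> : s = N by [lia]; rewrite eqc.
  have t1N : (t.-1 < N)%N by lia.
  move/forallP/(_ (Ordinal Ns))/forallP/(_ (Ordinal t1N))/implyP: le2 => /=.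
  have -> : (t.-1 < s)%N by lia.
  move=> /(_ isT).
  have E (M : 'M[nat]_N) : (\sum_(r < N | s <= r) \sum_(c < N | c <= t.-1) M r c =
     \sum_(r < N | s <= r) \sum_(c < N | c < t) M r c)%N.
    by apply: eq_bigr => r _; apply: eq_bigl => c; lia.
  rewrite !E.
  have := psum_compl_row A t sN; have := psum_compl_row B t sN.
  have := eqc _ tN; lia.
split; [exact/eqP/ro_psum|exact/eqP/co_psum|..].
- apply/forallP => i; apply/forallP => j; apply/implyP => ij.
  have iN := ltn_ord i; have jN := ltn_ord j.
  have E (M : 'M[nat]_N) : (\sum_(r < N | r <= i) \sum_(c < N | j <= c) M r c =
       \sum_(r < N | r < i.+1) \sum_(c < N | j <= c) M r c)%N by [].
  rewrite !E.
  have := psum_compl_col A i.+1 (ltnW jN); have := psum_compl_col B i.+1 (ltnW jN).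
  have := eqr _ iN; have := le _ _ iN (ltnW jN); lia.
- apply/forallP => i; apply/forallP => j; apply/implyP => ij.
  have iN := ltn_ord i; have jN := ltn_ord j.
  have E (M : 'M[nat]_N) : (\sum_(r < N | i <= r) \sum_(c < N | c <= j) M r c =
       \sum_(r < N | i <= r) \sum_(c < N | c < j.+1) M r c)%N by [].
  rewrite !E.
  have := psum_compl_row A j.+1 (ltnW iN); have := psum_compl_row B j.+1 (ltnW iN).
  have := eqc _ jN; have := le _ _ (ltnW iN) jN; lia.
Qed.

End PrefixSums.

Section FlagTheory.
Variables (n d : nat) (F : finFieldType).
Notation N := (2 * n).+1.
Notation space := {vspace 'rV[F]_(2 * d).+1}.
Notation flag := {ffun 'I_N.+1 -> space}.
Implicit Types (b : {symmetric 'rV[F]_(2 * d).+1}) (V W : flag).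

(** Natural-number indices spare the ordinal casts in index arithmetic; they are meaningful for t <=
    N. *)
Definition step V (t : nat) : space := V (inord t).

Lemma step_ord V (i : 'I_N.+1) : V i = step V i.
Proof. by rewrite /step inord_val. Qed.

Lemma flag_eqP V W : (forall t, (t <= N)%N -> step V t = step W t) -> V = W.
Proof. by move=> eqVW; apply/ffunP => i; rewrite !step_ord eqVW // -ltnS. Qed.

Lemma isflagP b V :
  reflect [/\ step V 0 = 0%VS, step V N = fullv,
              forall s t, (s <= t)%N -> (t <= N)%N -> (step V s <= step V t)%VS
            & forall s, (s <= N)%N -> step V s = orthov b (step V (N - s))]
          (isflag b V).
Proof.
have i0 : inord 0 = ord0 :> 'I_N.+1 by apply: val_inj; rewrite /= inordK.
have iN : inord N = ord_max :> 'I_N.+1 by apply: val_inj; rewrite /= inordK.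
have irev s : (s <= N)%N -> rev_ord (inord s : 'I_N.+1) = inord (N - s).
  by move=> sN; apply: val_inj; rewrite /= !inordK //; lia.
apply: (iffP and4P) => [[/eqP V0 /eqP VN mono orth]|[V0 VN mono orth]].
  split; rewrite /step ?i0 ?iN //.
  - move=> s t st tN; move/forallP/(_ (inord s))/forallP/(_ (inord t))/implyP: mono.
    by rewrite !inordK; [apply|lia|lia].
  - by move=> s sN; move/forallP/(_ (inord s))/eqP: orth => {1}->; rewrite irev.
split.
- by rewrite -i0 -/(step V 0) V0.
- by rewrite -iN -/(step V N) VN.
- apply/forallP => i; apply/forallP => j; apply/implyP => ij.
  by rewrite !step_ord mono // -ltnS.
- apply/forallP => i; apply/eqP; rewrite [LHS]step_ord orth -1?ltnS //.
  by rewrite [in RHS]step_ord /=; congr (orthov b (step V _)); lia.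
Qed.

(** By the dimension formula for sums, the entries of [relpos] are the mixed second differences of
    the dimensions of V_s cap W_t; monotonicity of the flags keeps the truncated subtraction
    exact. *)
Lemma relpos_psum b V W s t : isflag b V -> isflag b W -> (s <= N)%N -> (t <= N)%N ->
  psum (relpos V W) s t = \dim (step V s :&: step W t)%VS.
Proof.
move=> /isflagP[V0 _ monoV _] /isflagP[W0 _ monoW _].
apply: (psum_rect (f := fun s t => \dim (step V s :&: step W t)%VS)).
- by move=> u; rewrite V0 cap0v dimv0.
- by move=> u; rewrite W0 capv0 dimv0.
move=> i j; rewrite mxE -!/(step _ _).
have iN := ltn_ord i; have jN := ltn_ord j.
have dimE u : (u <= N)%N -> (\dim (step V i + step V i.+1 :&: step W u)%VS +
    \dim (step V i :&: step W u)%VS =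
    \dim (step V i) + \dim (step V i.+1 :&: step W u)%VS)%N.
  move=> uN; rewrite -(dimv_sum_cap (step V i)) capvA; congr (_ + \dim (_ :&: _)%VS)%N.
  by apply/esym/capv_idPl/monoV.
have := dimE j (ltnW jN); have := dimE j.+1 jN.
have : (\dim (step V i + step V i.+1 :&: step W j)%VS <=
        \dim (step V i + step V i.+1 :&: step W j.+1)%VS)%N.
  by apply: dimvS; rewrite addvS // capvS // monoW.
have : (\dim (step V i :&: step W j)%VS <= \dim (step V i :&: step W j.+1)%VS)%N.
  by apply: dimvS; rewrite capvS // monoW.
lia.
Qed.

Lemma relposP b V W (A : 'M[nat]_N) : isflag b V -> isflag b W ->
  (forall s t, (s <= N)%N -> (t <= N)%N ->
     \dim (step V s :&: step W t)%VS = psum A s t) <-> relpos V W = A.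
Proof.
move=> fV fW; split=> [eqA|<- s t sN tN]; last by rewrite (relpos_psum fV fW).
by apply: psum_inj => s t sN tN; rewrite (relpos_psum fV fW) // eqA.
Qed.

Lemma relpos_ro b V W s : isflag b V -> isflag b W -> (s <= N)%N ->
  psum (relpos V W) s N = \dim (step V s).
Proof.
move=> fV fW sN; rewrite (relpos_psum fV fW) //.
by case/isflagP: fW => _ -> _ _; rewrite capvf.
Qed.

Lemma relpos_co b V W t : isflag b V -> isflag b W -> (t <= N)%N ->
  psum (relpos V W) N t = \dim (step W t).
Proof.
move=> fV fW sN; rewrite (relpos_psum fV fW) //.
by case/isflagP: fV => _ -> _ _; rewrite capfv.
Qed.

End FlagTheory.

(** * Orthogonal complements *)

Section Orthogonal.
Variables (F : fieldType) (vT : vectType F) (b : {symmetric vT}).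
Implicit Types U V W : {vspace vT}.

Lemma orthovS U V : (U <= V)%VS -> (orthov b V <= orthov b U)%VS.
Proof.
move=> /subvP UV; apply/subvP => x /mem_orthovP xV.
by apply/mem_orthovP => y /UV; apply: xV.
Qed.

Lemma orthov_addv U V : orthov b (U + V)%VS = (orthov b U :&: orthov b V)%VS.
Proof.
apply/eqP; rewrite eqEsubv subv_cap !orthovS ?addvSl ?addvSr //=.
by rewrite orthov_sym subv_add; apply/andP; split;
  rewrite orthov_sym ?capvSl ?capvSr.
Qed.

Lemma sub_orthov2 U : (U <= orthov b (orthov b U))%VS.
Proof. by rewrite orthov_sym. Qed.

(** Each vector of a basis of V imposes one linear condition on W. *)
Lemma dim_cap_orthov_ge V W : (\dim W <= \dim (W :&: orthov b V)%VS + \dim V)%N.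
Proof.
suff span_ge (X : seq vT) : (\dim W <= \dim (W :&: orthov b <<X>>)%VS + size X)%N.
  by have := span_ge (vbasis V); rewrite (span_basis (vbasisP V)) size_tuple.
elim: X => [|u X IHX] /=.
  by rewrite span_nil orthov0 capvf addn0.
rewrite span_cons orthov_addv capvC -capvA capvC.
have := leq_dim_orthov1 b u (orthov b <<X>> :&: W)%VS.
rewrite capvC in IHX; lia.
Qed.

Hypothesis nd : nondegenerate b.

Lemma dim_orthov U : (\dim (orthov b U) + \dim U)%N = \dim {:vT}.
Proof.
have := dim_cap_orthov_ge U fullv; rewrite capfv => ge.
have := dim_cap_orthov_ge (orthov b U)^C%VS U.
(* A vector of U orthogonal to a complement of U^perp is also orthogonal to U^perp, hence to
   everything. *)
have -> : (U :&: orthov b (orthov b U)^C = 0)%VS.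
  apply/eqP; rewrite -subv0 -(eqP nd) -(addv_complf (orthov b U)).
  by rewrite orthov_addv capvS // sub_orthov2.
rewrite dimv0 dimv_compl; have := dimvS (subvf (orthov b U)); lia.
Qed.

Lemma orthovK U : orthov b (orthov b U) = U.
Proof.
apply/esym/eqP; rewrite eqEdim sub_orthov2 /=.
have := dim_orthov U; have := dim_orthov (orthov b U); lia.
Qed.

Lemma orthov_capv U V : orthov b (U :&: V)%VS = (orthov b U + orthov b V)%VS.
Proof. by rewrite -[RHS]orthovK orthov_addv !orthovK. Qed.

Lemma dim_cap_orthov U V :
  (\dim (orthov b U :&: orthov b V)%VS + \dim U + \dim V =
   \dim {:vT} + \dim (U :&: V)%VS)%N.
Proof.
rewrite -orthov_addv; have := dim_orthov (U + V)%VS.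
have := dimv_sum_cap U V; lia.
Qed.

End Orthogonal.

(** * Moving units between adjacent columns *)

Section Raising.
Variable n : nat.
Notation N := (2 * n).+1.
Implicit Types (A B C D X Y : 'M[nat]_N) (i h : 'I_N).

Definition rot_sym C := forall i j, C i j = C (rev_ord i) (rev_ord j).

(** Rotation turns this prefix into the lower right corner complementary to (s, t);
    inclusion-exclusion does the rest. *)
Lemma psum_rot C s t : rot_sym C -> (s <= N)%N -> (t <= N)%N ->
  (psum C (N - s) (N - t) + psum C s N + psum C N t = psum C N N + psum C s t)%N.
Proof.
move=> symC sN tN.
have -> : psum C (N - s) (N - t) =
    (\sum_(i < N | s <= i) \sum_(j < N | t <= j) C i j)%N.
  rewrite /psum (reindex_inj rev_ord_inj) /=; apply: eq_big => [i|i _].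
    by have := ltn_ord i; lia.
  rewrite (reindex_inj rev_ord_inj) /=; apply: eq_big => [j|j _].
    by have := ltn_ord j; lia.
  by rewrite [RHS]symC.
have := psum_compl_col C s tN; have := psum_compl_col C N tN.
rewrite sum_ord_lt_full (bigID (fun i : 'I_N => s <= i)%N) /=.
have -> : (\sum_(i < N | ~~ (s <= i)) \sum_(j < N | t <= j) C i j =
  \sum_(i < N | i < s) \sum_(j < N | t <= j) C i j)%N.
  by apply: eq_bigl => i; rewrite ltnNge.
by move=> <- <-; set a := bigop.body _ _ _; set b := bigop.body _ _ _; lia.
Qed.

(* C' is C with r units moved from column h+1 to column h in row i, and         *)
(* symmetrically in row rev_ord i; both sides are sums because subtraction of   *)
(* natural numbers truncates.                                                   *)
Record raising C C' i h (r : nat) : Prop := Raising {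
  raising_lt : (h < i)%N;
  raising_eq : C' + Etheta i (inord h.+1) *+ r = C + Etheta i h *+ r;
  raising_low : forall s c : 'I_N, (i < s)%N -> (c <= h.+1)%N -> C s c = 0%N;
  raising_col : C i h = 0%N }.

(** A move from column h+1 to column h is felt only by prefixes of exactly h+1 columns, and its
    rotated copy only by prefixes of N-1-h columns. These two numbers differ because N is odd. *)
Lemma raising_psum C C' i h r s t : raising C C' i h r -> (s <= N)%N -> (t <= N)%N ->
  (psum C' s t + r * ((N.-1 - i < s) && (t == N.-1 - h)) =
   psum C s t + r * ((i < s) && (t == h.+1)))%N.
Proof.
case=> hi eqC _ _ sN tN; have iN := ltn_ord i.
have := congr1 (fun M => psum M s t) eqC.
rewrite !psumD !psumMn !psumD !psum_delta /= inordK; last by lia.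
have shift (p : bool) a : (p && (a.+1 < t) + (p && (t == a.+1)) = p && (a < t))%N.
  by case: p => //=; case: (ltngtP a.+1 t).
have -> : (N - i.+1 = N.-1 - i)%N by lia.
have -> : (N - h.+1 = (N - h.+2).+1)%N by lia.
have -> : (N.-1 - h = (N - h.+2).+1)%N by lia.
rewrite -(shift _ h) -(shift _ (N - h.+2)%N) !mulnDl !(mulnC r).
move: (nat_of_bool _ * r)%N (nat_of_bool _ * r)%N (nat_of_bool _ * r)%N.
by move=> x1 x2 x3; move: (nat_of_bool _ * r)%N => x4; lia.
Qed.

Lemma raising_full C C' i h r s t : raising C C' i h r ->
  (i < s)%N -> (s <= N)%N -> (t <= h.+2)%N -> psum C s t = psum C N t.
Proof.
case=> hi _ low _ si sN th; rewrite -(psum_compl_row C t sN) big1 ?add0n // => k sk.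
by rewrite big1 // => l lt; rewrite low //; lia.
Qed.

Lemma psum_diag D s t : is_diag_mx D -> (s <= N)%N -> (t <= N)%N ->
  psum D s t = psum D N (minn s t).
Proof.
move=> /is_diag_mxP diagD sN tN.
have E m : psum D N m = (\sum_(k < N | k < m) D k k)%N.
  rewrite psum_co; apply: eq_bigr => k _; rewrite mxE (bigD1 k) //= big1 ?addn0 //.
  by move=> l lk; rewrite diagD // eq_sym.
rewrite E /psum (big_mkcond (fun k : 'I_N => k < minn s t)%N) /=.
rewrite big_mkcond /=; apply: eq_bigr => k _.
rewrite leq_min; case: (ltnP k s) => //= ks.
rewrite big_mkcond (bigD1 k) //= big1 ?addn0 // => l lk.
by rewrite diagD ?if_same // eq_sym.
Qed.

End Raising.

(** * Raising one step of a flag *)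

Lemma sub_of_dim_cap (K : fieldType) (vT : vectType K) (U V : {vspace vT}) :
  (\dim U <= \dim (U :&: V)%VS)%N -> (U <= V)%VS.
Proof.
move=> le; have /eqP <- : (U :&: V)%VS == U; last exact: capvSr.
by rewrite eqEdim capvSl.
Qed.

Section RaisedFlags.
Variables (n d : nat) (F : finFieldType).
Notation N := (2 * n).+1.
Notation space := {vspace 'rV[F]_(2 * d).+1}.
Notation flag := {ffun 'I_N.+1 -> space}.
Variable b : {symmetric 'rV[F]_(2 * d).+1}.
Hypothesis nd : nondegenerate b.
Implicit Types (V W : flag) (A B C D X Y : 'M[nat]_N) (i h : 'I_N).

(** The geometric form of a factor. With h counted from 0, the enlarged space has index h+1; the one
    of index N-1-h is its orthogonal complement and needs no clause of its own. *)
Definition raised V W (h r : nat) : Prop :=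
  [/\ forall t, (t <= N)%N -> t != h.+1 -> t != (N.-1 - h)%N -> step V t = step W t,
      (step V h.+1 <= step W h.+1)%VS, (step W h.+1 <= step V h.+2)%VS
    & \dim (step W h.+1) = (\dim (step V h.+1) + r)%N].

Lemma dim_flag_rot V W s t : isflag b V -> isflag b W -> (s <= N)%N -> (t <= N)%N ->
  (\dim (step V (N - s) :&: step W (N - t))%VS + \dim (step V s) + \dim (step W t) =
   \dim {: 'rV[F]_(2 * d).+1} + \dim (step V s :&: step W t)%VS)%N.
Proof.
move=> /isflagP[_ _ _ oV] /isflagP[_ _ _ oW] sN tN.
rewrite (oV (N - s)%N) ?leq_subr // (oW (N - t)%N) ?leq_subr //.
by rewrite !subKn // dim_cap_orthov.
Qed.

Lemma dim_step_rot V s : isflag b V -> (s <= N)%N ->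
  (\dim (step V (N - s)) + \dim (step V s) = \dim {: 'rV[F]_(2 * d).+1})%N.
Proof.
move=> /isflagP[_ _ _ oV] sN.
by rewrite (oV (N - s)%N) ?leq_subr // subKn // dim_orthov.
Qed.

Lemma step_cap V s t : isflag b V -> (s <= N)%N -> (t <= N)%N ->
  (step V s :&: step V t)%VS = step V (minn s t).
Proof.
case/isflagP=> _ _ mono _ sN tN; case: leqP => st.
  by apply/capv_idPl/mono.
by apply/capv_idPr/mono => //; exact: ltnW.
Qed.

(** Here [D] is the diagonal matrix recording the dimension jumps of V, not the diagonal part of the
    factor [B]. All inclusions are read off from equalities of dimensions. *)
Lemma raised_of_relpos V W D B h1 h r : isflag b V -> isflag b W ->
    is_diag_mx D -> raising D B h1 h r -> h1 = h.+1 :> nat -> relpos V W = B ->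
  raised V W h r.
Proof.
move=> fV fW diagD rD h1E relB; have h1N := ltn_ord h1.
have [_ _ monoV oV] := isflagP _ _ fV; have [_ _ monoW oW] := isflagP _ _ fW.
have dimD t : (t <= N)%N -> psum D N t = \dim (step V t).
  move=> tN; rewrite -(relpos_ro fV fW tN) relB.
  have := raising_psum rD tN (leqnn N).
  by rewrite (psum_diag diagD) // (minn_idPl tN); lia.
have dimW t : (t <= N)%N -> (\dim (step W t) + r * (t == N.-1 - h) =
    \dim (step V t) + r * (t == h.+1))%N.
  move=> tN; rewrite -(relpos_co fV fW tN) relB -dimD //.
  by have := raising_psum rD (leqnn N) tN; rewrite !ltn_ord /=; lia.
have capVW s t : (s <= N)%N -> (t <= N)%N ->
    (\dim (step V s :&: step W t)%VS + r * ((N.-1 - h1 < s) && (t == N.-1 - h)) =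
     \dim (step V (minn s t)) + r * ((h1 < s) && (t == h.+1)))%N.
  move=> sN tN; rewrite -(relpos_psum fV fW) // relB.
  have := raising_psum rD sN tN; rewrite (psum_diag diagD) // dimD //.
  by rewrite geq_min sN.
have hN : (h.+2 <= N)%N by lia.
have hN1 := ltnW hN.
split.
- move=> t tN /negPf th /negPf tNh; have := capVW t t tN tN; have := dimW t tN.
  rewrite minnn th tNh !andbF => dW dVW.
  have VW : (step V t <= step W t)%VS by apply: sub_of_dim_cap; lia.
  by apply/eqP; rewrite eqEdim VW /=; lia.
- apply: sub_of_dim_cap; have := capVW _ _ hN1 hN1; rewrite minnn.
  by rewrite h1E; lia.
- rewrite -h1E in hN *; apply: sub_of_dim_cap; rewrite capvC.
  have := dimW _ hN1; have := capVW _ _ hN hN1; rewrite (minn_idPr _); last by lia.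
  by rewrite -h1E; lia.
- by have := dimW _ hN1; lia.
Qed.

Lemma relpos_of_raised V W D B h1 h r : isflag b V -> isflag b W ->
    is_diag_mx D -> raising D B h1 h r -> h1 = h.+1 :> nat ->
    (forall t, (t <= N)%N -> psum D N t = \dim (step V t)) ->
    raised V W h r ->
  relpos V W = B.
Proof.
move=> fV fW diagD rD h1E dimD [eqVW VW WV dW]; have h1N := ltn_ord h1.
have [_ _ monoV oV] := isflagP _ _ fV; have [_ _ monoW oW] := isflagP _ _ fW.
have hN : (h.+2 <= N)%N by lia.
have hN1 := ltnW hN.
apply/(relposP B fV fW) => s t sN tN.
have := raising_psum rD sN tN; rewrite (psum_diag diagD) // dimD ?geq_min ?sN //.
have capVh u : (u <= N)%N -> (\dim (step V u :&: step W h.+1)%VS =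
    \dim (step V (minn u h.+1)) + r * (h.+1 < u))%N.
  move=> uN; case: (leqP u h.+1) => uh.
    rewrite muln0 addn0; congr (\dim _); apply/capv_idPl.
    by apply: subv_trans VW; apply: monoV.
  rewrite muln1 -dW; congr (\dim _); apply/capv_idPr.
  by apply: subv_trans WV _; apply: monoV.
case: (eqVneq t h.+1) => [->|th].
  by rewrite capVh // h1E; lia.
case: (eqVneq t (N.-1 - h)%N) => [tE|th']; last first.
  by rewrite -eqVW // (step_cap fV) //; lia.
have := dim_flag_rot fV fW (leq_subr s N) hN1.
have := dim_step_rot fV hN1; have := dim_step_rot fV sN.
have -> : (N - h.+1 = t)%N by lia.
rewrite subKn // capVh ?leq_subr // dW => dVs dVh dst.
have dmin : (\dim (step V (minn (N - s) h.+1)) + \dim (step V s)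
   = \dim (step V (minn s t)) + \dim (step V h.+1))%N.
  have := dim_flag_rot fV fV (leq_subr s N) hN1.
  rewrite subKn // !(step_cap fV) ?leq_subr //.
  have -> : (N - h.+1 = t)%N by lia.
  lia.
by rewrite h1E; lia.
Qed.

Lemma raised_dim_co V W h r t : isflag b V -> isflag b W -> raised V W h r ->
    (h.+1 < N)%N -> (t <= N)%N ->
  (\dim (step W t) + r * (t == N.-1 - h) = \dim (step V t) + r * (t == h.+1))%N.
Proof.
move=> fV fW [eqVW VW WV dW] hN tN.
case: (eqVneq t h.+1) => [->|th]; first by rewrite dW; lia.
case: (eqVneq t (N.-1 - h)%N) => [tE|th']; last by rewrite eqVW.
have -> : t = (N - h.+1)%N by lia.
have := dim_step_rot fV (ltnW hN); have := dim_step_rot fW (ltnW hN); lia.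
Qed.

(** Only the prefixes with h+1 columns need an argument, the dual ones following by rotation. For s
    <= i the prefix sum of C' is that of C, and V_{h+1} lies in W_{h+1}. For s > i the whole of
    W_{h+1} lies in V1_s. If the position of W is C', the same inequalities are squeezed to
    equalities for V. *)
Lemma Xi_le_raised V1 V W C C' i h r : isflag b V1 -> isflag b V -> isflag b W ->
    raised V W h r -> raising C C' i h r -> rot_sym C -> rot_sym C' ->
    Xi_le (relpos V1 V) C ->
  Xi_le (relpos V1 W) C' /\ (relpos V1 W = C' -> relpos V1 V = C).
Proof.
move=> f1 fV fW rVW rC symC symC' /Xi_leP[roC coC leC].
have hi : (h < i)%N by case: rC.
have iN := ltn_ord i.
have hN : (h.+2 <= N)%N by lia.
have hN1 := ltnW hN.
have pC := raising_psum rC; have dW := raised_dim_co fV fW rVW hN.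
have [eqVW VW WV dWh] := rVW.
have [_ _ mono1 o1] := isflagP _ _ f1.
have roE s : (s <= N)%N -> psum C s N = \dim (step V1 s).
  by move=> sN; rewrite -roC // (relpos_ro f1 fV).
have coE t : (t <= N)%N -> psum C N t = \dim (step V t).
  by move=> tN; rewrite -coC // (relpos_co f1 fV).
have leE s t : (s <= N)%N -> (t <= N)%N ->
    (psum C s t <= \dim (step V1 s :&: step V t)%VS)%N.
  by move=> sN tN; rewrite -(relpos_psum f1 fV) // leC.
have roE' s : (s <= N)%N -> psum C' s N = \dim (step V1 s).
  by move=> sN; rewrite -roE //; have := pC s N sN (leqnn N); lia.
have coE' t : (t <= N)%N -> psum C' N t = \dim (step W t).
  move=> tN; have := pC N t (leqnn N) tN; have := dW t tN; rewrite coE //; lia.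
have NN : psum C N N = \dim {: 'rV[F]_(2 * d).+1}.
  by rewrite roE //; case/isflagP: f1 => _ -> _ _.
have NN' : psum C' N N = \dim {: 'rV[F]_(2 * d).+1}.
  by rewrite roE' //; case/isflagP: f1 => _ -> _ _.
(* The first h+2 columns of C live in rows up to i, so V_{h+2}, which contains W_{h+1}, lies in
   V1_s. *)
have V1W s : (i < s)%N -> (s <= N)%N -> (step W h.+1 <= step V1 s)%VS.
  move=> si sN; apply: (subv_trans WV); apply: sub_of_dim_cap; rewrite capvC.
  apply: leq_trans (leE _ _ sN hN).
  by rewrite (raising_full rC si sN) ?coE.
have VhC s : (i < s)%N -> (s <= N)%N -> psum C s h.+1 = \dim (step V h.+1).
  by move=> si sN; rewrite (raising_full rC si sN) ?coE.
have le_h s : (s <= N)%N -> (psum C' s h.+1 <= \dim (step V1 s :&: step W h.+1)%VS)%N.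
  move=> sN; have := pC s h.+1 sN hN1; case: (leqP s i) => si.
    have := leE s h.+1 sN hN1.
    have : (\dim (step V1 s :&: step V h.+1)%VS <= \dim (step V1 s :&: step W h.+1)%VS)%N.
      by apply: dimvS; rewrite capvS.
    by lia.
  rewrite VhC // -coE // (capv_idPr (V1W s si sN)) dWh coE //; lia.
split.
  apply/Xi_leP; split=> [s sN|t tN|s t sN tN].
  - by rewrite (relpos_ro f1 fW) // roE'.
  - by rewrite (relpos_co f1 fW) // coE'.
  rewrite (relpos_psum f1 fW) //.
  case: (eqVneq t h.+1) => [->|th]; first exact: le_h.
  case: (eqVneq t (N.-1 - h)%N) => [tE|th']; last first.
    have := pC s t sN tN; have := leE s t sN tN.
    by rewrite (negPf th) (negPf th') !andbF eqVW //; lia.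
  have tE' : t = (N - h.+1)%N by lia.
  have := dim_flag_rot f1 fW (leq_subr s N) hN1.
  have := psum_rot symC' (leq_subr s N) hN1.
  rewrite subKn // -tE' NN' roE' ?leq_subr // coE' //.
  have := le_h _ (leq_subr s N); lia.
move=> eqC'; apply/(relposP C f1 fV).
have eqE s t : (s <= N)%N -> (t <= N)%N ->
    \dim (step V1 s :&: step W t)%VS = psum C' s t.
  by move=> sN tN; rewrite -eqC' (relpos_psum f1 fW).
have eq_h s : (s <= N)%N -> \dim (step V1 s :&: step V h.+1)%VS = psum C s h.+1.
  move=> sN; have := pC s h.+1 sN hN1; case: (leqP s i) => si.
    have := leE s h.+1 sN hN1; have := eqE s h.+1 sN hN1.
    have : (\dim (step V1 s :&: step V h.+1)%VS <= \dim (step V1 s :&: step W h.+1)%VS)%N.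
      by apply: dimvS; rewrite capvS.
    by lia.
  by rewrite VhC // (capv_idPr (subv_trans VW (V1W s si sN))).
move=> s t sN tN.
case: (eqVneq t h.+1) => [->|th]; first exact: eq_h.
case: (eqVneq t (N.-1 - h)%N) => [tE|th']; last first.
  have := pC s t sN tN; have := eqE s t sN tN.
  by rewrite (negPf th) (negPf th') !andbF eqVW //; lia.
have tE' : t = (N - h.+1)%N by lia.
have := dim_flag_rot f1 fV (leq_subr s N) hN1.
have := psum_rot symC (leq_subr s N) hN1.
rewrite subKn // -tE' NN roE ?leq_subr // coE //.
have := eq_h _ (leq_subr s N); lia.
Qed.

End RaisedFlags.

(** * The unique middle flag *)

Section MiddleFlag.
Variables (n d : nat) (F : finFieldType).
Notation N := (2 * n).+1.
Notation space := {vspace 'rV[F]_(2 * d).+1}.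
Notation flag := {ffun 'I_N.+1 -> space}.
Variable b : {symmetric 'rV[F]_(2 * d).+1}.
Hypothesis nd : nondegenerate b.
Variables (V1 V2 : flag) (C C' : 'M[nat]_N) (i h : 'I_N) (r : nat).
Hypotheses (f1 : isflag b V1) (f2 : isflag b V2) (rel12 : relpos V1 V2 = C').
Hypotheses (rC : raising C C' i h r) (symC : rot_sym C).

Definition midspace : space := (step V2 h + step V2 h.+1 :&: step V1 i)%VS.

Definition midflag : flag :=
  [ffun t : 'I_N.+1 => if t == h.+1 :> nat then midspace
     else if t == (N.-1 - h)%N :> nat then orthov b midspace else V2 t].

Let hi : (h < i)%N. Proof. by case: rC. Qed.
Let hN : (h.+2 <= N)%N. Proof. have := ltn_ord i; have := hi; lia. Qed.
Let hN1 : (h.+1 <= N)%N := ltnW hN.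
Let hN0 : (h <= N)%N := ltnW hN1.
Let iN : (i < N)%N := ltn_ord i.
Let iN' : (i <= N)%N := ltnW iN.

Let dim12 s t : (s <= N)%N -> (t <= N)%N ->
  \dim (step V1 s :&: step V2 t)%VS = psum C' s t.
Proof. by move=> sN tN; rewrite -rel12 (relpos_psum f1 f2). Qed.

Let dim2 t : (t <= N)%N -> \dim (step V2 t) = psum C' N t.
Proof. by move=> tN; rewrite -rel12 (relpos_co f1 f2). Qed.

Let pC s t := @raising_psum n C C' i h r s t rC.

Let mono1 s t : (s <= t)%N -> (t <= N)%N -> (step V1 s <= step V1 t)%VS.
Proof. by case/isflagP: f1 => _ _ + _; apply. Qed.
Let mono2 s t : (s <= t)%N -> (t <= N)%N -> (step V2 s <= step V2 t)%VS.
Proof. by case/isflagP: f2 => _ _ + _; apply. Qed.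
Let orth1 s : (s <= N)%N -> step V1 s = orthov b (step V1 (N - s)).
Proof. by case/isflagP: f1 => _ _ _ ; apply. Qed.
Let orth2 s : (s <= N)%N -> step V2 s = orthov b (step V2 (N - s)).
Proof. by case/isflagP: f2 => _ _ _ ; apply. Qed.

Lemma midspace_sub : (midspace <= step V2 h.+1)%VS.
Proof. by rewrite subv_add capvSl mono2. Qed.

(** Column h of C' has entry r in row i and zeros below it; intersecting with V1_i keeps only the
    rows above row i. *)
Lemma dim_midspace : (\dim midspace + r)%N = \dim (step V2 h.+1).
Proof.
have := dimv_sum_cap (step V2 h) (step V2 h.+1 :&: step V1 i)%VS.
rewrite -/midspace capvA (capv_idPl (mono2 (leqnSn h) hN1)).
rewrite ![(_ :&: step V1 i)%VS]capvC !dim12 // !dim2 //.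
have := psumSS C i h; case: (rC) => _ _ _ ->.
have ii : (i < i.+1)%N by [].
rewrite (raising_full rC ii iN (leqnSn h.+1)).
rewrite (raising_full rC ii iN (leqW (leqnSn h))).
have := pC (leqnn N) hN1; have := pC iN' hN0; have := pC (leqnn N) hN0.
have := pC iN' hN1; rewrite iN ltnn !eqxx; have := hi; lia.
Qed.

Lemma step2_sub_step1 s : (i < s)%N -> (s <= N)%N -> (step V2 h.+1 <= step V1 s)%VS.
Proof.
move=> si sN; apply: subv_trans (mono1 si sN).
apply: sub_of_dim_cap; rewrite capvC dim12 // dim2 //.
have ii : (i < i.+1)%N by [].
have := raising_full rC ii iN (leqnSn h.+1).
have := pC (leqnn N) hN1; have := pC iN hN1; rewrite iN !eqxx /=; lia.
Qed.

Lemma step_midflag t : (t <= N)%N -> step midflag t =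
  if t == h.+1 then midspace
  else if t == (N.-1 - h)%N then orthov b midspace else step V2 t.
Proof. by move=> tN; rewrite /step ffunE inordK. Qed.

Lemma sub_orthov_midspace : (step V2 (N.-1 - h) <= orthov b midspace)%VS.
Proof.
rewrite orth2; last by lia.
by rewrite orthovS // (_ : N - (N.-1 - h) = h.+1)%N ?midspace_sub //; lia.
Qed.

Lemma orthov_midspace_sub_step : (orthov b midspace <= step V2 (N - h))%VS.
Proof. by rewrite orth2 ?leq_subr // subKn // orthovS // addvSl. Qed.

(** For h >= n the dual index N-1-h precedes h+1, so this inclusion is needed for a flag. An x in
    the complement is a + c with a in V2_{N-1-h}, which lies in V2_h, and c in V1_{N-i}, which lies
    in V1_i; then c = x - a also lies in V2_{h+1}. *)
Lemma orthov_midspace_sub : (n <= h)%N -> (orthov b midspace <= midspace)%VS.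
Proof.
move=> nh; rewrite {1}/midspace orthov_addv orthov_capv //.
have -> : orthov b (step V2 h) = step V2 (N - h).
  by rewrite [RHS]orth2 ?leq_subr // subKn.
have -> : orthov b (step V2 h.+1) = step V2 (N.-1 - h).
  by rewrite [RHS]orth2; [congr (orthov b (step V2 _))|]; lia.
have -> : orthov b (step V1 i) = step V1 (N - i).
  by rewrite [RHS]orth1 ?leq_subr // subKn.
apply/subvP => x /memv_capP[xV2 /memv_addP[a aV2 [c cV1 xE]]].
have aVh : a \in step V2 h by apply: subvP aV2; apply: mono2 => //; lia.
rewrite xE memv_add // memv_cap; apply/andP; split.
  have -> : c = x - a by rewrite xE addrC addKr.
  rewrite memvB //; first by apply: subvP xV2; apply: mono2 => //; lia.
  by apply: subvP aVh; apply: mono2.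
by apply: subvP cV1; apply: mono1; have := hi; lia.
Qed.

Lemma isflag_midflag : isflag b midflag.
Proof.
have [V0 VN _ _] := isflagP _ _ f2.
have q1N : (N.-1 - h < N)%N by lia.
have qE : ((N.-1 - h).+1 = N - h)%N by lia.
apply/isflagP; split.
- rewrite step_midflag //.
  have -> : (0 == N.-1 - h)%N = false by lia.
  by [].
- rewrite step_midflag //.
  have -> : (N == h.+1)%N = false by lia.
  have -> : (N == N.-1 - h)%N = false by lia.
  by [].
- move=> s t st tN; rewrite !step_midflag //; last by exact: leq_trans tN.
  case: (eqVneq s h.+1) => [sE|sh]; case: (eqVneq t h.+1) => [tE|th] //.
  + case: (eqVneq t (N.-1 - h)%N) => [tE|th'].
      apply: subv_trans midspace_sub (subv_trans _ sub_orthov_midspace).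
      by apply: mono2; lia.
    by apply: subv_trans midspace_sub _; apply: mono2; lia.
  + case: (eqVneq s (N.-1 - h)%N) => [sE|sh'].
      by apply: orthov_midspace_sub; lia.
    by apply: subv_trans (addvSl _ _); apply: mono2; lia.
  + case: (eqVneq s (N.-1 - h)%N) => [sE|sh'];
      case: (eqVneq t (N.-1 - h)%N) => [tE|th'] //.
    * by apply: subv_trans orthov_midspace_sub_step _; apply: mono2; lia.
    * by apply: subv_trans _ sub_orthov_midspace; apply: mono2; lia.
    * exact: mono2.
- move=> s sN; rewrite !step_midflag ?leq_subr //.
  case: (eqVneq s h.+1) => [sE|sh].
    have -> : (N - s == h.+1)%N = false by lia.
    have -> : (N - s == N.-1 - h)%N = true by lia.
    by rewrite orthovK.
  case: (eqVneq s (N.-1 - h)%N) => [sE|sh'].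
    by have -> : (N - s == h.+1)%N = true by lia.
  have -> : (N - s == h.+1)%N = false by lia.
  have -> : (N - s == N.-1 - h)%N = false by lia.
  exact: orth2.
Qed.

Lemma raised_midflag : raised midflag V2 h r.
Proof.
have sE : step midflag h.+1 = midspace by rewrite step_midflag // eqxx.
split; rewrite ?sE ?dim_midspace ?midspace_sub //.
- by move=> t tN /negPf th /negPf th'; rewrite step_midflag // th th'.
- rewrite step_midflag //; have -> : (h.+2 == h.+1)%N = false by lia.
  case: eqP => [hE|_]; last exact: mono2.
  apply: subv_trans sub_orthov_midspace; apply: mono2; lia.
Qed.

Lemma relpos_midflag : relpos V1 midflag = C.
Proof.
apply/(relposP C f1 isflag_midflag).
have roE s : (s <= N)%N -> psum C s N = \dim (step V1 s).
  move=> sN; rewrite -(relpos_ro f1 f2 sN) rel12.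
  by have := pC sN (leqnn N); lia.
have coh : psum C N h.+1 = \dim midspace.
  have := dim_midspace; rewrite dim2 //; have := pC (leqnn N) hN1.
  rewrite iN eqxx; lia.
have NN : psum C N N = \dim {: 'rV[F]_(2 * d).+1}.
  by rewrite roE //; case/isflagP: f1 => _ -> _ _.
have sE : step midflag h.+1 = midspace by rewrite step_midflag // eqxx.
have eq_h s : (s <= N)%N -> \dim (step V1 s :&: step midflag h.+1)%VS = psum C s h.+1.
  move=> sN; rewrite sE; case: (leqP s i) => si; last first.
    rewrite (capv_idPr (subv_trans midspace_sub (step2_sub_step1 si sN))).
    by rewrite (raising_full rC si sN) ?coh.
  have -> : (step V1 s :&: midspace = step V1 s :&: step V2 h.+1)%VS.
    apply/eqP; rewrite eqEsubv capvS ?midspace_sub //= subv_cap capvSl /=.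
    apply: subv_trans (addvSr _ _); rewrite capvC capvS //.
    by apply: mono1.
  by rewrite dim12 //; have := pC sN hN1; lia.
move=> s t sN tN.
case: (eqVneq t h.+1) => [->|th]; first exact: eq_h.
case: (eqVneq t (N.-1 - h)%N) => [tE|th']; last first.
  rewrite step_midflag // (negPf th) (negPf th') dim12 //.
  by have := pC sN tN; rewrite (negPf th) (negPf th'); lia.
have tE' : t = (N - h.+1)%N by lia.
have := dim_flag_rot nd f1 isflag_midflag (leq_subr s N) hN1.
have := psum_rot symC (leq_subr s N) hN1.
rewrite subKn // -tE' NN roE ?leq_subr // coh sE -sE.
have := eq_h _ (leq_subr s N); lia.
Qed.

(** V_{h+1} must contain V2_h, and also V2_{h+1} cap V1_i because C and C' agree on the prefix (i,
    h+1). Their sum already has the right dimension. *)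
Lemma raised_uniq V : isflag b V -> relpos V1 V = C -> raised V V2 h r -> V = midflag.
Proof.
move=> fV rel1V [eqV VV2 _ dV].
have [_ _ monoV orthV] := isflagP _ _ fV.
have Vh : step V h.+1 = midspace.
  apply/esym/eqP; rewrite eqEdim; apply/andP; split; last first.
    by have := dim_midspace; lia.
  rewrite subv_add; apply/andP; split.
    apply: subv_trans (monoV _ _ (leqnSn h) hN1).
    (* For h = n the space of index h is the dual of the enlarged one, so V2_h lies in V_h by taking
       complements. *)
    case: (eqVneq (h : nat) (N.-1 - h)%N) => [hE|hh]; last by rewrite eqV //; lia.
    have -> : (h : nat) = (N - h.+1)%N by lia.
    rewrite orth2 ?leq_subr // orthV ?leq_subr // subKn //.
    exact: orthovS.
  rewrite capvC.
  have <- : (step V1 i :&: step V h.+1 = step V1 i :&: step V2 h.+1)%VS.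
    apply/eqP; rewrite eqEdim capvS //= dim12 //.
    rewrite -(relpos_psum f1 fV) // rel1V.
    have := pC iN' hN1; lia.
  exact: capvSr.
apply: flag_eqP => t tN; rewrite step_midflag //.
case: (eqVneq t h.+1) => [->//|th]; case: (eqVneq t (N.-1 - h)%N) => [tE|th'].
  rewrite orthV // -Vh; congr (orthov b (step V _)); lia.
exact: eqV.
Qed.

End MiddleFlag.

Lemma card_mid_flags n d (F : finFieldType) (b : {symmetric 'rV[F]_(2 * d).+1})
    V1 V2 (C C' B : Xi n d) D (i h h1 : 'I_(2 * n).+1) r :
    nondegenerate b -> isflag b V1 -> isflag b V2 -> relpos V1 V2 = C' ->
    raising C C' i h r -> is_diag_mx D -> co D = co C -> raising D B h1 h r ->
    h1 = h.+1 :> nat -> rot_sym C ->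
  #|mid_flags b C B V1 V2| = 1%N.
Proof.
move=> nd f1 f2 rel12 rC diagD coD rD h1E symC.
have fM := isflag_midflag nd f1 f2 rC.
have relM := relpos_midflag nd f1 f2 rel12 rC symC.
have rM := raised_midflag nd f1 f2 rel12 rC.
suff -> : mid_flags b C B V1 V2 = [set midflag b V1 V2 i h] by rewrite cards1.
apply/setP => V; rewrite !inE; apply/and3P/eqP => [[fV /eqP rel1 /eqP rel2]|->].
  apply: (raised_uniq nd f1 f2 rel12 rC fV rel1).
  exact: (raised_of_relpos nd fV f2 diagD rD h1E rel2).
split=> //; apply/eqP => //.
apply: (relpos_of_raised nd fM f2 diagD rD h1E _ rM) => t tN.
by rewrite -(relpos_co f1 fM tN) relM; move: t tN; apply/co_psum.
Qed.

(** * Every symmetric matrix is a relative position *)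

Section CoordinateSpaces.
Variables (F : fieldType) (D : nat).
Implicit Types (S T : {set 'I_D}) (x y : 'rV[F]_D).

Definition coordv S : {vspace 'rV[F]_D} := (\sum_(k in S) <[delta_mx 0%R k]>)%VS.

Lemma mem_coordvP S x :
  reflect (forall k, k \notin S -> x 0 k = 0) (x \in coordv S).
Proof.
apply: (iffP idP) => [/memv_sumP[y yP ->] k kS|x0].
  rewrite summxE big1 // => l lS; have /vlineP[a ->] := yP l lS.
  by rewrite !mxE eqxx /= eq_sym (negPf (memPn kS l lS)) // mulr0.
rewrite [x]row_sum_delta (bigID (mem S)) /= [X in _ + X]big1 ?addr0; last first.
  by move=> k kS; rewrite x0 // scale0r.
by apply: memv_sumr => k kS; rewrite memvZ // memv_line.
Qed.

Lemma coordv_setI S T : (coordv S :&: coordv T)%VS = coordv (S :&: T).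
Proof.
apply/vspaceP => x; apply/memv_capP/mem_coordvP => [[/mem_coordvP xS /mem_coordvP xT] k|x0].
  by rewrite inE negb_and => /orP[/xS|/xT].
by split; apply/mem_coordvP => k kN; apply: x0; rewrite inE (negPf kN) ?andbF.
Qed.

Lemma coordvS S T : S \subset T -> (coordv S <= coordv T)%VS.
Proof.
move=> /subsetP ST; apply/subvP => x /mem_coordvP xS.
by apply/mem_coordvP => k kT; apply: xS; apply: contra kT; apply: ST.
Qed.

Lemma coordv0 : coordv set0 = 0%VS. Proof. exact: big_set0. Qed.

Lemma coordvT : coordv setT = fullv.
Proof. by apply/vspaceP => x; rewrite memvf; apply/mem_coordvP => k; rewrite inE. Qed.

(** The upper bounds for S and for its complement add up to the dimension of the whole space, so
    both are attained. *)
Lemma dim_coordv S : \dim (coordv S) = #|S|.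
Proof.
have dim_le T : (\dim (coordv T) <= #|T|)%N.
  apply: leq_trans (dimv_leq_sum _ _ _) _; rewrite -sum1_card.
  by apply: leq_sum => k _; rewrite dim_vline; case: (_ != _).
have := dimv_sum_cap (coordv S) (coordv (~: S)).
rewrite coordv_setI setICr coordv0 dimv0.
have -> : (coordv S + coordv (~: S) = fullv)%VS.
  rewrite /coordv -coordvT /coordv [RHS](bigID (mem S)) /=; congr (_ + _)%VS.
    by apply: eq_bigl => k; rewrite !inE.
  by apply: eq_bigl => k; rewrite !inE.
rewrite dimvf /dim /= mul1n; have := dim_le S; have := dim_le (~: S).
have := cardsC S; rewrite card_ord.
by move: (\dim _) (\dim _) #|S| #|~: S|; lia.
Qed.

(** The antidiagonal form, for which the orthogonal complement of a coordinate subspace is again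
    one. *)
Definition revform x y : F := \sum_k x 0 k * y 0 (rev_ord k).

Fact revform_bilinear : bilinear_for *%R (idfun \; *%R) revform.
Proof.
split=> u a x y; rewrite /revform /= mulr_sumr -big_split; apply: eq_bigr => k _.
  by rewrite !mxE mulrDl mulrA.
by rewrite !mxE mulrDr mulrCA.
Qed.

HB.instance Definition _ :=
  bilinear_isBilinear.Build F _ _ _ *%R (idfun \; *%R) revform revform_bilinear.

Fact revform_sym x y : revform x y = (-1) ^+ false * idfun (revform y x).
Proof.
rewrite expr0 mul1r /revform (reindex_inj rev_ord_inj) /=.
by apply: eq_bigr => k _; rewrite rev_ordK mulrC.
Qed.

HB.instance Definition _ :=
  isHermitianSesquilinear.Build F _ false idfun revform revform_sym.

Lemma revform_delta x k : revform x (delta_mx 0 k) = x 0 (rev_ord k).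
Proof.
rewrite /revform (bigD1 (rev_ord k)) //= rev_ordK mxE !eqxx mulr1 big1 ?addr0 //.
move=> l lk; rewrite mxE eqxx /= (_ : rev_ord l == k = false) ?mulr0 //.
by apply: contraNF lk => /eqP <-; rewrite rev_ordK.
Qed.

Lemma orthov_coordv S :
  orthov revform (coordv S) = coordv (~: [set k | rev_ord k \in S]).
Proof.
apply/vspaceP => x; apply/mem_orthovP/mem_coordvP => [xS k|x0 y /mem_coordvP yS].
  rewrite !inE negbK => kS; rewrite -[k]rev_ordK -revform_delta; apply: xS.
  apply/mem_coordvP => l lS; have lk := memPn lS _ kS.
  by rewrite mxE eqxx /= eq_sym (negPf lk).
rewrite /= /revform big1 // => k _; case: (boolP (rev_ord k \in S)) => kS.
  by rewrite x0 ?mul0r // !inE negbK.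
by rewrite yS ?mulr0.
Qed.

Lemma revform_nondegenerate : nondegenerate revform.
Proof.
rewrite /nondegenerate -coordvT orthov_coordv -coordv0; apply/eqP; congr (coordv _).
by apply/setP => k; rewrite !inE.
Qed.

End CoordinateSpaces.

Lemma rev_enum_ord N : rev (enum 'I_N) = map (@rev_ord N) (enum 'I_N).
Proof.
case: N => [|N]; first by rewrite [enum _]size0nil // size_enum_ord.
apply: (@eq_from_nth _ ord0); first by rewrite size_rev size_map.
move=> k; rewrite size_rev size_enum_ord => kN; apply: val_inj.
rewrite /= nth_rev ?size_enum_ord // nth_enum_ord; last by lia.
by rewrite (nth_map ord0) ?size_enum_ord //= nth_enum_ord.
Qed.

Lemma rev_flatten_enum N (T : Type) (f g : 'I_N -> seq T) :
    (forall i, rev (f (rev_ord i)) = g i) ->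
  rev (flatten (map f (enum 'I_N))) = flatten (map g (enum 'I_N)).
Proof.
move=> fg; rewrite rev_flatten -map_comp -map_rev rev_enum_ord -map_comp.
by congr flatten; apply: eq_map => i /=; rewrite fg.
Qed.

Section Realization.
Variables (n d : nat) (F : finFieldType) (Y : Xi n d).
Notation N := (2 * n).+1.
Notation D := (2 * d).+1.

(* The k-th basis vector belongs to the k-th cell of the list in which the cell *)
(* (i, j) is repeated Y i j times, in lexicographic order: reversing this list  *)
(* rotates the cells.                                                           *)
Definition labels : seq ('I_N * 'I_N) :=
  flatten [seq flatten [seq nseq (Y i j) (i, j) | j <- enum 'I_N] | i <- enum 'I_N].

Lemma count_labels (p : pred ('I_N * 'I_N)) :
  count p labels = (\sum_i \sum_j p (i, j) * Y i j)%N.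
Proof.
rewrite count_flatten -map_comp sumnE big_map big_enum; apply: eq_bigr => i _ /=.
rewrite count_flatten -map_comp sumnE big_map big_enum; apply: eq_bigr => j _ /=.
by rewrite count_nseq.
Qed.

Lemma size_labels : size labels = D.
Proof.
have /andP[/eqP <- _] := XiP Y; rewrite -(count_predT labels) count_labels.
by apply: eq_bigr => i _; apply: eq_bigr => j _; rewrite mul1n.
Qed.

Lemma rev_labels : rev labels = [seq (rev_ord p.1, rev_ord p.2) | p <- labels].
Proof.
have /andP[_ /forallP symY] := XiP Y.
rewrite /labels map_flatten -map_comp; apply: rev_flatten_enum => i /=.
rewrite map_flatten -map_comp; apply: rev_flatten_enum => j /=.
by rewrite rev_nseq map_nseq; have /forallP/(_ j)/eqP -> := symY i.
Qed.

Definition label (k : 'I_D) := nth (ord0, ord0) labels k.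

Lemma label_rev k : label (rev_ord k) = (rev_ord (label k).1, rev_ord (label k).2).
Proof.
rewrite /label -(nth_map _ (ord0, ord0) (fun p => (rev_ord p.1, rev_ord p.2))) //.
  by rewrite -rev_labels nth_rev size_labels.
by rewrite size_labels.
Qed.

Lemma card_label (p : pred ('I_N * 'I_N)) :
  #|[set k | p (label k)]| = (\sum_i \sum_j p (i, j) * Y i j)%N.
Proof.
rewrite -count_labels -sum1_card -sum1_count (big_nth (ord0, ord0)) size_labels.
by rewrite big_mkord; apply: eq_bigl => k; rewrite inE.
Qed.

Definition label_flag (f : 'I_N * 'I_N -> 'I_N) : {ffun 'I_N.+1 -> {vspace 'rV[F]_D}} :=
  [ffun t : 'I_N.+1 => coordv F [set k | f (label k) < t]%N].

Lemma step_label_flag f t : (t <= N)%N ->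
  step (label_flag f) t = coordv F [set k | f (label k) < t]%N.
Proof. by move=> tN; rewrite /step ffunE inordK. Qed.

Lemma isflag_label_flag f : (forall i j, f (rev_ord i, rev_ord j) = rev_ord (f (i, j))) ->
  isflag (@revform F D) (label_flag f).
Proof.
move=> f_rev; apply/isflagP; split.
- rewrite step_label_flag // -(coordv0 F D); congr (coordv _ _).
- rewrite step_label_flag // -(coordvT F D); congr (coordv _ _).
  by apply/setP => k; rewrite !inE ltn_ord.
- move=> s t st tN; rewrite !step_label_flag //; last exact: leq_trans tN.
  by apply: coordvS; apply/subsetP => k; rewrite !inE => /leq_trans; apply.
- move=> s sN; rewrite !step_label_flag ?leq_subr // orthov_coordv; congr (coordv _ _).
  apply/setP => k; rewrite !inE label_rev f_rev -surjective_pairing /=.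
  by have := ltn_ord (f (label k)); lia.
Qed.

(** Basis vectors labelled by cells (i, j) span V1_s where i < s and V2_t where j < t, so the
    intersections count cells. The rotation of the labels makes both flags self-dual for the
    antidiagonal form. *)
Lemma realization : exists (b : {symmetric 'rV[F]_D})
    (V1 V2 : {ffun 'I_N.+1 -> {vspace 'rV[F]_D}}),
  [/\ nondegenerate b, isflag b V1, isflag b V2 & relpos V1 V2 = Y].
Proof.
exists (@revform F D), (label_flag fst), (label_flag snd).
have f1 : isflag (@revform F D) (label_flag fst) by apply: isflag_label_flag.
have f2 : isflag (@revform F D) (label_flag snd) by apply: isflag_label_flag.
split=> //; first exact: revform_nondegenerate.
apply/(relposP Y f1 f2) => s t sN tN; rewrite !step_label_flag //.
rewrite coordv_setI dim_coordv.
set p : pred ('I_N * 'I_N) := fun q => (q.1 < s)%N && (q.2 < t)%N.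
rewrite (_ : _ :&: _ = [set k | p (label k)]); last by apply/setP => k; rewrite !inE.
rewrite card_label.
rewrite /psum [RHS]big_mkcond; apply: eq_bigr => i _ /=.
rewrite /p /=; case: (i < s)%N; last by apply: big1.
rewrite [RHS]big_mkcond; apply: eq_bigr => j _ /=.
by case: (j < t)%N; rewrite ?mul1n.
Qed.

End Realization.

(** * The standard degree as a quadratic form *)

Section StandardDegree.
Variable n : nat.
Notation N := (2 * n).+1.
Implicit Types (A B C D M : 'M[nat]_N) (i h : 'I_N).

(** Kept bilinear, so that the quadratic form can be polarized when a matrix is raised. *)
Definition inversions A B : nat :=
  (\sum_(i < N) \sum_(k < N | k <= i) \sum_(j < N) \sum_(l < N | j < l) A i j * B k l)%N.

Definition corner A : nat := (\sum_(i < N | n <= i) \sum_(j < N | j < n) A i j)%N.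

Lemma sum_indicator (I : finType) (P : pred I) (G : I -> nat) :
  (\sum_(i | P i) G i = \sum_i P i * G i)%N.
Proof.
by rewrite big_mkcond; apply: eq_bigr => i _; case: (P i); rewrite ?mul1n.
Qed.

Lemma sum_swap_rev m (G : 'I_m -> 'I_m -> nat) :
  (\sum_i \sum_k G i k = \sum_i \sum_k G (rev_ord k) (rev_ord i))%N.
Proof.
rewrite exchange_big (reindex_inj rev_ord_inj) /=; apply: eq_bigr => i _.
by rewrite (reindex_inj rev_ord_inj).
Qed.

Lemma double_half_pred a : (a * (a - 1) %/ 2 * 2 + a = a * a)%N.
Proof.
case: a => // k; rewrite subn1 /= divn2 muln2.
have := odd_double_half (k.+1 * k); rewrite oddM /= andNb add0n => ->; lia.
Qed.

(* The rows i > k and N + 1 - k > N + 1 - i contribute equally, and i + k < N + 1 *)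
(* selects one of these two pairs; for k = N + 1 - i the pairs of columns (j, l)   *)
(* and (N + 1 - l, N + 1 - j) contribute equally.                                 *)
Lemma inversions_dstd A : rot_sym A -> (2 * dstd A + corner A = inversions A A)%N.
Proof.
move=> symA.
pose P i k := (\sum_(j < N) \sum_(l < N | j < l) A i j * A k l)%N.
have PE i k : P i k = (\sum_(j < N) \sum_(l < N) (j < l) * (A i j * A k l))%N.
  by apply: eq_bigr => j _; rewrite sum_indicator.
have P_rev i k : P (rev_ord k) (rev_ord i) = P i k.
  rewrite !PE sum_swap_rev; apply: eq_bigr => j _; apply: eq_bigr => l _.
  rewrite -!symA mulnC [(A k l * _)%N]mulnC mulnC; congr (_ * _)%N.
  by have := ltn_ord j; have := ltn_ord l => /=; case: (ltnP j l); lia.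
pose U i := (\sum_(j < N) \sum_(l < N | (j < l) && (j + l < 2 * n)) A i j * A i l)%N.
have UE i : U i = (\sum_(j < N) \sum_(l < N) ((j < l) && (j + l < 2 * n)) * (A i j * A i l))%N.
  by apply: eq_bigr => j _; rewrite sum_indicator.
(* Reflecting l turns j < l into the symmetric condition j + l < 2n, which splits into j < l, j > l
   and j = l < n. *)
have PU i : P i (rev_ord i) = (2 * U i + \sum_(j < N | j < n) A i j * A i j)%N.
  have -> : (\sum_(j < N | j < n) A i j * A i j =
      \sum_(j < N) \sum_(l < N) ((j == l :> nat) && (j < n)) * (A i j * A i l))%N.
    rewrite sum_indicator; apply: eq_bigr => j _; rewrite (bigD1 j) //= eqxx big1 ?addn0 //.
    by move=> l /negPf lj; rewrite eq_sym val_eqE lj.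
  rewrite (mul2n (U i)) -addnn {2}UE exchange_big UE -!big_split PE; apply: eq_bigr => j _ /=.
  rewrite (reindex_inj rev_ord_inj) -!big_split; apply: eq_bigr => l _ /=.
  rewrite -symA (mulnC (A i l)) -!mulnDl; congr (_ * _)%N.
  by have := ltn_ord l; lia.
have -> : inversions A A = (\sum_(i < N) \sum_(k < N) (k <= i) * P i k)%N.
  by apply: eq_bigr => i _; rewrite sum_indicator.
pose S1 := (\sum_(i < N) \sum_(k < N) ((k < i) && (i + k < 2 * n)) * P i k)%N.
have S2E : (\sum_(i < N) \sum_(k < N) ((k < i) && (2 * n < i + k)) * P i k = S1)%N.
  rewrite sum_swap_rev; apply: eq_bigr => i _; apply: eq_bigr => k _.
  rewrite P_rev; congr (_ * _)%N; have := ltn_ord i; have := ltn_ord k => /=; lia.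
(* The pairs k < i are split by i + k below, above or equal to 2n, and the pairs i = k by the sign
   of i - n; the middle pair i = k = n joins the antidiagonal sum. *)
have qE : (\sum_(i < N) \sum_(k < N) (k <= i) * P i k =
    S1 + S1 + (\sum_(i < N) (i < n) * P i i + \sum_(i < N) (i < n) * P i i
       + \sum_(i < N) (n <= i) * P i (rev_ord i)))%N.
  have P_diag : (\sum_(i < N) (n < i) * P i i = \sum_(i < N) (i < n) * P i i)%N.
    rewrite (reindex_inj rev_ord_inj); apply: eq_bigr => i _; rewrite P_rev.
    by congr (_ * _)%N; have := ltn_ord i => /=; lia.
  rewrite -{2}P_diag -{1}S2E -!big_split; apply: eq_bigr => i _ /=.
  have -> : ((i < n) * P i i + (n < i) * P i i + (n <= i) * P i (rev_ord i) =
      \sum_(k < N) ((k < i) && (i + k == 2 * n)) * P i k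
      + \sum_(k < N) (k == i :> nat) * P i k)%N.
    have -> : (\sum_(k < N) (k == i :> nat) * P i k = P i i)%N.
      rewrite (bigD1 i) //= eqxx mul1n big1 ?addn0 // => k /negPf ki.
      by rewrite val_eqE ki.
    have -> : (\sum_(k < N) ((k < i) && (i + k == 2 * n)) * P i k =
               (n < i) * P i (rev_ord i))%N.
      rewrite (bigD1 (rev_ord i)) //= big1 ?addn0; last first.
        move=> k ki; have -> : (i + k == 2 * n)%N = false; last by rewrite andbF.
        by apply: contraNF ki => /eqP ik; apply/eqP/val_inj => /=; lia.
      by congr (_ * _)%N; have := ltn_ord i; lia.
    case: (ltngtP i n) => [lt|gt|eq_in]; rewrite ?mul0n ?mul1n; try lia.
    suff -> : rev_ord i = i by lia.
    by apply: val_inj => /=; lia.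
  rewrite -!big_split; apply: eq_bigr => k _ /=; rewrite -!mulnDl; congr (_ * _)%N.
  lia.
have T1E : S1 = (\sum_(i < N) \sum_(k < N | (k < i) && (i + k < 2 * n)) P i k)%N.
  by apply: eq_bigr => i _; rewrite [RHS]sum_indicator.
have T2E : (\sum_(i < N) \sum_(j < N)
      \sum_(l < N | (j < l) && ((i < n) || (j + l < 2 * n))) A i j * A i l =
    \sum_(i < N) (i < n) * P i i + \sum_(i < N) (n <= i) * U i)%N.
  rewrite -big_split; apply: eq_bigr => i _ /=; case: (ltnP i n) => ni.
    by rewrite mul1n addn0; apply: eq_bigr => j _; apply: eq_bigl => l; rewrite andbT.
  by rewrite add0n mul1n.
have T3E : (2 * (\sum_(i < N | n <= i) \sum_(j < N | j < n) (A i j * (A i j - 1)) %/ 2)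
    + corner A + 2 * (\sum_(i < N) (n <= i) * U i) =
    \sum_(i < N) (n <= i) * P i (rev_ord i))%N.
  rewrite /corner !big_distrr /= !(sum_indicator (fun i : 'I_N => n <= i)%N) -!big_split.
  apply: eq_bigr => i _ /=; rewrite PU; case: (n <= i)%N; rewrite ?mul0n ?mul1n ?muln0 //.
  rewrite addnC; congr (_ + _)%N.
  rewrite big_distrr -big_split; apply: eq_bigr => j _ /=.
  by rewrite mulnC double_half_pred.
rewrite qE /dstd -T3E T2E -[X in (2 * (X + _ + _))%N]T1E.
clear S2E qE T1E T2E T3E.
move: (\sum_(i < N) (i < n) * P i i)%N (\sum_(i < N) (n <= i) * U i)%N S1 => a u s.
move: (\sum_(i < N | n <= i) _)%N (corner A) => x c; lia.
Qed.

Lemma inversionsDl A B M : inversions (A + B) M = (inversions A M + inversions B M)%N.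
Proof.
rewrite /inversions -big_split; apply: eq_bigr => i _.
rewrite -big_split; apply: eq_bigr => k _.
rewrite -big_split; apply: eq_bigr => j _.
rewrite -big_split; apply: eq_bigr => l _.
by rewrite mxE; apply: mulnDl.
Qed.

Lemma inversionsDr A B M : inversions M (A + B) = (inversions M A + inversions M B)%N.
Proof.
rewrite /inversions -big_split; apply: eq_bigr => i _.
rewrite -big_split; apply: eq_bigr => k _.
rewrite -big_split; apply: eq_bigr => j _.
rewrite -big_split; apply: eq_bigr => l _.
by rewrite mxE; apply: mulnDr.
Qed.

Lemma inversionsMnl A M r : inversions (A *+ r) M = (r * inversions A M)%N.
Proof.
elim: r => [|r IHr]; last by rewrite mulrS inversionsDl IHr mulSn.
rewrite mul0n /inversions big1 // => i _; rewrite big1 // => k _.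
by rewrite big1 // => j _; rewrite big1 // => l _; rewrite mxE.
Qed.

Lemma inversionsMnr A M r : inversions M (A *+ r) = (r * inversions M A)%N.
Proof.
elim: r => [|r IHr]; last by rewrite mulrS inversionsDr IHr mulSn.
rewrite mul0n /inversions big1 // => i _; rewrite big1 // => k _.
by rewrite big1 // => j _; rewrite big1 // => l _; rewrite mxE muln0.
Qed.

Lemma inversions_deltal (a b : 'I_N) M :
  (inversions (delta_mx a b) M + psum M a.+1 b.+1 = psum M a.+1 N)%N.
Proof.
rewrite -(psum_compl_col M a.+1 (ltn_ord b)); congr (_ + _)%N.
rewrite /inversions (bigD1 a) //= [X in (_ + X)%N]big1 ?addn0; last first.
  move=> i ia; rewrite big1 // => k _; rewrite big1 // => j _; rewrite big1 // => l _.
  by rewrite mxE (negPf ia).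
apply: eq_bigr => k _; rewrite (bigD1 b) //= [X in (_ + X)%N]big1 ?addn0; last first.
  by move=> j jb; rewrite big1 // => l _; rewrite mxE (negPf jb) andbF.
by apply: eq_bigr => l _; rewrite mxE !eqxx mul1n.
Qed.

Lemma inversions_deltar (a b : 'I_N) M :
  (inversions M (delta_mx a b) + psum M a b = psum M N b)%N.
Proof.
rewrite -(psum_compl_row M b (ltnW (ltn_ord a))); congr (_ + _)%N.
rewrite [RHS]sum_indicator; apply: eq_bigr => i _.
rewrite sum_indicator (bigD1 a) //= [X in (_ + X)%N]big1 ?addn0; last first.
  move=> k ka; rewrite big1 ?muln0 // => j _; rewrite big1 // => l _.
  by rewrite mxE (negPf ka) muln0.
congr (_ * _)%N; rewrite [RHS]sum_indicator; apply: eq_bigr => j _.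
rewrite sum_indicator (bigD1 b) //= [X in (_ + X)%N]big1 ?addn0; last first.
  by move=> l lb; rewrite mxE (negPf lb) andbF !muln0.
by rewrite mxE !eqxx muln1.
Qed.

Lemma inversions_delta (a b c e : 'I_N) :
  inversions (delta_mx a b) (delta_mx c e) = ((c <= a) && (b < e))%N.
Proof.
have := inversions_deltal a b (delta_mx c e); rewrite !psum_delta.
have := ltn_ord e; lia.
Qed.

Lemma corner_psum M : (corner M + psum M n n = psum M N n)%N.
Proof. by rewrite psum_compl_row //; lia. Qed.

(** The row i does not enter the formula: the change of d is governed by h, r and the sum of column
    h+1, written as a difference of two prefix sums. The boolean marks the case where that column is
    the middle one. *)
Lemma raising_dstd C C' i h r : raising C C' i h r -> rot_sym C -> rot_sym C' ->
  (2 * dstd C' + r * r * (2 + (h.+1 == n)) + r * (h.+1 == n) + 2 * r * psum C N h.+1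
   = 2 * dstd C + 2 * r * psum C N h.+2)%N.
Proof.
move=> rC symC symC'; have [hi eqC _ Cih] := rC; have iN := ltn_ord i.
have eq_corner : (corner C' = corner C + r * (h.+1 == n))%N.
  have := corner_psum C; have := corner_psum C'.
  have nN : (n <= N)%N by lia.
  have := raising_psum rC (leqnn N) nN; have := raising_psum rC nN nN; lia.
have := inversions_dstd symC'; have := inversions_dstd symC; rewrite eq_corner.
set E1 := Etheta i h in eqC; set E2 := Etheta i (inord h.+1) in eqC.
(* The polar form of C with E1 - E2 is twice the sum of column h+1. *)
have lin : (inversions C E1 + inversions E1 C + 2 * psum C N h.+1 =
            inversions C E2 + inversions E2 C + 2 * psum C N h.+2)%N.
  rewrite /E1 /E2 /Etheta !(inversionsDl, inversionsDr).
  have h1E : (inord h.+1 : 'I_N) = h.+1 :> nat by rewrite inordK //; lia.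
  have := inversions_deltal i h C; have := inversions_deltar i h C.
  have := inversions_deltal i (inord h.+1) C; have := inversions_deltar i (inord h.+1) C.
  have := inversions_deltal (rev_ord i) (rev_ord h) C.
  have := inversions_deltar (rev_ord i) (rev_ord h) C.
  have := inversions_deltal (rev_ord i) (rev_ord (inord h.+1)) C.
  have := inversions_deltar (rev_ord i) (rev_ord (inord h.+1)) C.
  rewrite /= h1E.
  have -> : (N - i.+1).+1 = (N - i)%N by lia.
  have -> : (N - h.+1).+1 = (N - h)%N by lia.
  have -> : (N - h.+2).+1 = (N - h.+1)%N by lia.
  have hN2 : (h.+2 <= N)%N by lia.
  have hN1 : (h.+1 <= N)%N by lia.
  have hN0 : (h <= N)%N by lia.
  have iN0 : (i <= N)%N by lia.
  have := psum_rot symC iN hN2; have := psum_rot symC iN hN1.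
  have := psum_rot symC iN0 hN1; have := psum_rot symC iN0 hN0.
  have := psum_rot symC (leq0n N) hN1; have := psum_rot symC (leq0n N) hN2.
  rewrite !psum0l subn0.
  have ii : (i < i.+1)%N by [].
  have := raising_full rC ii iN (leqnn h.+2); have := raising_full rC ii iN (leqnSn h.+1).
  have := raising_full rC ii iN (leqW (leqnSn h)).
  have := psumSS C i h; rewrite Cih; lia.
(* The quadratic form takes the value -2 on E1 - E2, or -3 in the middle case. *)
have quad : (inversions E1 E1 + inversions E2 E2 + (2 + (h.+1 == n)) =
             inversions E1 E2 + inversions E2 E1)%N.
  clear lin eq_corner.
  rewrite /E1 /E2 /Etheta !(inversionsDl, inversionsDr) !inversions_delta /= inordK; last by lia.
  have -> : (h < N - h.+1)%N = (h < n)%N by lia.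
  have -> : (h < N - h.+2)%N = (h < n)%N by lia.
  have -> : (h.+1 < N - h.+1)%N = (h < n)%N by lia.
  have -> : (h.+1 < N - h.+2)%N = (h.+1 < n)%N by lia.
  have -> : (N - h.+1 < h)%N = (n < h)%N by lia.
  have -> : (N - h.+1 < h.+1)%N = (n <= h)%N by lia.
  have -> : (N - h.+2 < h)%N = (n <= h)%N by lia.
  have -> : (N - h.+2 < h.+1)%N = (n <= h)%N by lia.
  have -> : (N - h.+1 < N - h.+2)%N = false by lia.
  have -> : (N - h.+2 < N - h.+1)%N = true by lia.
  have -> : (N - i.+1 <= i)%N = (n <= i)%N by lia.
  have -> : (i <= N - i.+1)%N = (i <= n)%N by lia.
  have -> : (h < h.+1)%N = true by lia.
  have -> : (h.+1 < h)%N = false by lia.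
  rewrite !leqnn !ltnn /=; lia.
clearbody E1 E2.
(* Without subtraction, C' = C + r (E1 - E2) is expanded by pairing C' + r E2 = C + r E1 with itself
   and with E2. *)
have qq := congr1 (fun M => inversions M M) eqC.
have q2 := congr1 (fun M => inversions M E2) eqC.
have q2' := congr1 (fun M => inversions E2 M) eqC.
rewrite /= !(inversionsDl, inversionsDr, inversionsMnl, inversionsMnr) in qq q2 q2'.
have rq2 := congr1 (muln r) q2; have rq2' := congr1 (muln r) q2'.
have rlin := congr1 (muln r) lin; have rquad := congr1 (muln (r * r)) quad.
clear lin quad q2 q2' eq_corner; move: qq rq2 rq2' rlin rquad.
move: (inversions C C) (inversions C' C') (inversions C E1) (inversions E1 C).
move: (inversions C E2) (inversions E2 C) (inversions C' E2) (inversions E2 C').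
move: (inversions E1 E1) (inversions E1 E2) (inversions E2 E1) (inversions E2 E2).
move: (dstd C) (dstd C') (corner C) (psum C N h.+1) (psum C N h.+2) (nat_of_bool _).
move=> dC dC' cC p1 p2 e x11 x12 x21 x22 a b c f g k l m.
clear; rewrite !mulnDr !mulnA; lia.
Qed.

End StandardDegree.

(** * The leading matrices of the partial products *)

Section RotationSymmetric.
Variable n : nat.
Notation N := (2 * n).+1.
Implicit Types (A B C M : 'M[nat]_N) (i j h : 'I_N).

Lemma roD A B : ro (A + B) = ro A + ro B.
Proof.
apply/rowP => i; rewrite !mxE -big_split; apply: eq_bigr => j _.
by rewrite mxE.
Qed.

Lemma coD A B : co (A + B) = co A + co B.
Proof.
apply/rowP => i; rewrite !mxE -big_split; apply: eq_bigr => j _.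
by rewrite mxE.
Qed.

Lemma sum_delta_row i j s : (\sum_c (delta_mx i j : 'M[nat]_N) s c = (s == i))%N.
Proof.
rewrite (bigD1 j) //= mxE eqxx andbT big1 ?addn0 ?natn // => c /negPf cj.
by rewrite mxE cj andbF.
Qed.

Lemma sum_delta_col i j c : (\sum_s (delta_mx i j : 'M[nat]_N) s c = (c == j))%N.
Proof.
rewrite (bigD1 i) //= mxE eqxx /= big1 ?addn0 ?natn // => s /negPf si.
by rewrite mxE si.
Qed.

Lemma EthetaE i j s c : (Etheta i j s c =
  (s == i) * (c == j) + (s == rev_ord i) * (c == rev_ord j))%N.
Proof. by rewrite !mxE !mulnb !natn. Qed.

Lemma mulmx_natE A r s c : ((A *+ r) s c = A s c * r)%N.
Proof.
elim: r => [|r IHr]; first by rewrite mulr0n mxE muln0.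
by rewrite mulrS mxE IHr mulnS.
Qed.

Lemma ro_Etheta i j r s : (ro (Etheta i j *+ r) 0%R s = r * ((s == i) + (s == rev_ord i)))%N.
Proof.
rewrite mxE (eq_bigr (fun c => r * Etheta i j s c))%N; last first.
  by move=> c _; rewrite mulmx_natE mulnC.
rewrite -big_distrr /=; congr (_ * _)%N; rewrite -(sum_delta_row i j).
rewrite -(sum_delta_row (rev_ord i) (rev_ord j)) -big_split.
by apply: eq_bigr => c _; rewrite mxE.
Qed.

Lemma co_Etheta i j r c : (co (Etheta i j *+ r) 0%R c = r * ((c == j) + (c == rev_ord j)))%N.
Proof.
rewrite mxE (eq_bigr (fun s => r * Etheta i j s c))%N; last first.
  by move=> s _; rewrite mulmx_natE mulnC.
rewrite -big_distrr /=; congr (_ * _)%N; rewrite -(sum_delta_col i j).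
rewrite -(sum_delta_col (rev_ord i) (rev_ord j)) -big_split.
by apply: eq_bigr => s _; rewrite mxE.
Qed.

Lemma rot_symD A B : rot_sym A -> rot_sym B -> rot_sym (A + B).
Proof. by move=> sA sB i j; rewrite !mxE sA sB. Qed.

Lemma rot_symMn A r : rot_sym A -> rot_sym (A *+ r).
Proof. by move=> sA i j; rewrite !mulmx_natE sA. Qed.

Lemma rot_sym_Etheta i j : rot_sym (Etheta i j).
Proof.
move=> s c; rewrite !EthetaE addnC.
by rewrite !(inj_eq rev_ord_inj) !(can2_eq rev_ordK rev_ordK).
Qed.

(** Rotation carries the strictly lower part to the strictly upper one, and the row sums then force
    the diagonal. *)
Lemma eq_of_lower A B : rot_sym A -> rot_sym B -> ro A = ro B ->
  (forall s c : 'I_N, (c < s)%N -> A s c = B s c) -> A = B.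
Proof.
move=> sA sB eqr low.
have off s c : s != c -> A s c = B s c.
  move=> sc; case: (ltnP c s) => [|le_sc]; first exact: low.
  rewrite sA sB; apply: low => /=; have := ltn_ord c.
  have : s != c :> nat by []. lia.
apply/matrixP => s c; case: (eqVneq s c) => [->|]; last exact: off.
have /rowP/(_ c) := eqr; rewrite !mxE (bigD1 c) // [RHS](bigD1 c) //=.
rewrite (eq_bigr (fun k => B c k)); last by move=> k kc; rewrite off // eq_sym.
by move/addIn.
Qed.

Lemma rot_sym_Xi d (A : Xi n d) : rot_sym A.
Proof. by have /andP[_ /forallP sA] := XiP A => i j; have /forallP/(_ j)/eqP := sA i. Qed.

Lemma Xi_predE d A : rot_sym A -> (psum A N N = (2 * d).+1)%N -> Xi_pred d A.
Proof.
move=> sA sumA; apply/andP; split.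
  apply/eqP; rewrite -sumA /psum sum_ord_lt_full; apply: eq_bigr => i _.
  by rewrite sum_ord_lt_full.
by apply/forallP => i; apply/forallP => j; apply/eqP.
Qed.

Lemma psum_Xi d (A : Xi n d) : psum A N N = (2 * d).+1%N.
Proof.
have /andP[/eqP <- _] := XiP A.
by rewrite /psum sum_ord_lt_full; apply: eq_bigr => i _; rewrite sum_ord_lt_full.
Qed.

Lemma ro_rot A s : rot_sym A -> ro A 0 (rev_ord s) = ro A 0 s.
Proof.
move=> sA; rewrite !mxE (reindex_inj rev_ord_inj); apply: eq_bigr => c _.
by rewrite -sA.
Qed.

Lemma co_rot A s : rot_sym A -> co A 0 (rev_ord s) = co A 0 s.
Proof.
move=> sA; rewrite !mxE (reindex_inj rev_ord_inj); apply: eq_bigr => c _.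
by rewrite -sA.
Qed.

End RotationSymmetric.

Section Stages.
Variables (n d : nat) (A : Xi n d).
Notation N := (2 * n).+1.
Implicit Types (i j h s c : 'I_N) (x : nat).

(* For x = h+1 (resp. x = h), [stage i j x] is the leading matrix of the product *)
(* of the factors preceding (resp. up to) the triple (i, h, j), and [lower i j x] *)
(* its strictly lower triangular part: the rows above i are finished, and the    *)
(* entry a_{ij} has been moved from the diagonal to column x.                    *)
Definition lower i j x s c : nat :=
  if (c < s)%N then
    if (s < i)%N then A s c
    else if s == i then (if (c < j)%N then A s c else if c == x :> nat then A s j else 0%N)
    else 0%N
  else 0%N.

Definition stage i j x : 'M[nat]_N := \matrix_(s, c)
  if (c < s)%N then lower i j x s c
  else if (s < c)%N then lower i j x (rev_ord s) (rev_ord c)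
  else (ro A 0%R s - \sum_k lower i j x s k - \sum_k lower i j x (rev_ord s) k)%N.

Lemma sum_lower_le i j x s : (j <= x)%N ->
  (\sum_k lower i j x s k <= \sum_(k < N | k < s) A s k)%N.
Proof.
move=> jx; case: (ltngtP s i) => [lt|gt|/val_inj ->].
- rewrite [leqRHS]big_mkcond; apply: leq_sum => k _; rewrite /lower lt.
  by case: ifP.
- rewrite big1 // => k _; rewrite /lower (ltnNge s i) (ltnW gt) /=.
  by rewrite -val_eqE gtn_eqF // if_same.
- case: (ltnP j i) => ji; last first.
    rewrite [leqRHS]big_mkcond; apply: leq_sum => k _; rewrite /lower ltnn eqxx.
    by case: ltnP => ki //; rewrite (leq_trans ki ji).
  rewrite (bigD1 j ji) /=.
  have -> : (\sum_k lower i j x i k = \sum_(k < N) ((k == x :> nat) && (j <= k < i)) * A i j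
      + \sum_(k < N) ((k < i) && (k < j)) * A i k)%N.
    rewrite -big_split; apply: eq_bigr => k _ /=.
    rewrite /lower ltnn eqxx; case: (ltnP k i) => ki; last by rewrite !andbF.
    by case: ltnP => kj; case: (k == x :> nat); rewrite ?mul1n ?addn0.
  apply: leq_add.
    case: (ltnP x N) => xN; last first.
      rewrite big1 // => k _; rewrite (_ : (k == x :> nat) = false) //.
      by have := ltn_ord k; lia.
    rewrite (bigD1 (Ordinal xN)) //= big1 ?addn0; last first.
      move=> k kx; have -> : (k == x :> nat) = false; last by [].
      by apply: contraNF kx => /eqP kx; apply/eqP/val_inj.
    by case: (_ && _); rewrite ?mul1n.
  rewrite [leqRHS]big_mkcond; apply: leq_sum => k _ /=.
  case: (k < i)%N => //=; case: eqVneq => [->|_]; first by rewrite ltnn.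
  by case: (k < j)%N; rewrite ?mul1n.
Qed.

(** This keeps the truncated subtraction on the diagonal of [stage] exact: the part of row s right
    of the diagonal is the rotated lower part of row [rev_ord s], and neither part exceeds that of
    A. *)
Lemma sum_lower_split i j x s : (j <= x)%N ->
  (\sum_k lower i j x s k + \sum_k lower i j x (rev_ord s) k + A s s <= ro A 0%R s)%N.
Proof.
move=> jx; have := sum_lower_le i s jx; have := sum_lower_le i (rev_ord s) jx.
have -> : (ro A 0%R s = \sum_(k < N | k < s) A s k
    + \sum_(k < N | k < rev_ord s) A (rev_ord s) k + A s s)%N.
  rewrite mxE (bigD1 s) //= addnC; congr (_ + _)%N.
  rewrite (bigID (fun k : 'I_N => k < s)%N) /=; congr (_ + _)%N.
    by apply: eq_bigl => k; case: eqVneq => [->|]; rewrite ?ltnn.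
  rewrite [RHS](reindex_inj rev_ord_inj); apply: eq_big => [k|k _].
    by rewrite -val_eqE /=; have := ltn_ord k; lia.
  by rewrite [LHS](rot_sym_Xi A).
lia.
Qed.

Lemma sum_stage_upper i j x s :
  (\sum_(k < N | s < k) stage i j x s k = \sum_k lower i j x (rev_ord s) k)%N.
Proof.
rewrite [RHS](reindex_inj rev_ord_inj) big_mkcond; apply: eq_bigr => k _.
rewrite mxE; case: (ltnP s k) => sk; first by rewrite ltnNge (ltnW sk).
by rewrite /lower /= (_ : (N - k.+1 < N - s.+1)%N = false) //; lia.
Qed.

Lemma ro_stage i j x : (j <= x)%N -> ro (stage i j x) = ro A.
Proof.
move=> jx; apply/rowP => s; rewrite mxE.
rewrite (bigD1 s) //= (bigID (fun k : 'I_N => k < s)%N) /=.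
have -> : (\sum_(k < N | (k != s) && (k < s)) stage i j x s k = \sum_k lower i j x s k)%N.
  rewrite big_mkcond; apply: eq_bigr => k _; rewrite mxE.
  case: (ltnP k s) => ks; last by rewrite andbF /lower ltnNge ks.
  by rewrite andbT -val_eqE neq_ltn ks.
have -> : (\sum_(k < N | (k != s) && ~~ (k < s)) stage i j x s k =
           \sum_(k < N | s < k) stage i j x s k)%N.
  by apply: eq_bigl => k; rewrite -val_eqE /=; lia.
rewrite sum_stage_upper [stage _ _ _ s s]mxE ltnn.
have := sum_lower_split i s jx; lia.
Qed.

Lemma rot_sym_stage i j x : rot_sym (stage i j x).
Proof.
move=> s c; rewrite !mxE /= !rev_ordK; have := ltn_ord s; have := ltn_ord c => cN sN.
case: (ltngtP c s) => [cs|sc|/val_inj ->].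
- have -> : (N - c.+1 < N - s.+1)%N = false by lia.
  by have -> : (N - s.+1 < N - c.+1)%N = true by lia.
- by have -> : (N - c.+1 < N - s.+1)%N = true by lia.
rewrite ltnn -!subnDA addnC; congr (_ - _)%N.
have /= := ro_rot s (rot_sym_Xi A).
by rewrite [RHS]mxE mxE => ->.
Qed.

Lemma stage_Xi_proof i j x (jx : (j <= x)%N) : Xi_pred d (stage i j x).
Proof.
apply: Xi_predE; first exact: rot_sym_stage.
have /ro_psum -> // := ro_stage i jx; exact: psum_Xi.
Qed.

Definition stageXi i j x (jx : (j <= x)%N) : Xi n d := MkXi (stage_Xi_proof i jx).

(** It suffices to compare strictly lower parts. When h+1 = i the units come from the diagonal,
    whose change is forced by the row sums. *)
Lemma raising_stage i j h : (j <= h)%N -> (h < i)%N ->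
  raising (stage i j h.+1) (stage i j h) i h (A i j).
Proof.
move=> jh hi; split=> //.
- apply: eq_of_lower.
  + by apply: rot_symD (rot_sym_stage _ _ _) (rot_symMn _ (rot_sym_Etheta _ _)).
  + by apply: rot_symD (rot_sym_stage _ _ _) (rot_symMn _ (rot_sym_Etheta _ _)).
  + rewrite !roD !ro_stage //; last exact: leqW.
    by congr (_ + _); apply/rowP => s; rewrite !ro_Etheta.
  move=> s c cs; rewrite [LHS]mxE [RHS]mxE !mulmx_natE !EthetaE !mxE cs.
  have iN := ltn_ord i.
  have Nrev (k : 'I_N) : (k <= i)%N -> ((s == rev_ord i) * (c == rev_ord k) = 0)%N.
    move=> ki; apply/eqP; rewrite muln_eq0 !eqb0 -negb_and; apply/negP.
    by move=> /andP[/eqP sE /eqP cE]; move: cs; rewrite sE cE /=; lia.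
  rewrite !Nrev ?addn0; [|exact: ltnW|by rewrite inordK //; lia].
  rewrite /lower cs; case: (eqVneq s i) => [->|si]; last by rewrite !mul0n.
  have h1 : (inord h.+1 : 'I_N) = h.+1 :> nat by rewrite inordK //; lia.
  rewrite ltnn !mul1n -!val_eqE /= h1; have hj := jh.
  case: (ltnP c j) => cj.
    rewrite (_ : (c == h.+1 :> nat) = false); last by lia.
    by rewrite (_ : (c == h :> nat) = false) //; lia.
  case: (eqVneq (c : nat) h) => [->|_].
    by rewrite (_ : (h == h.+1 :> nat) = false) ?mul0n ?mul1n //; lia.
  by case: (c == h.+1 :> nat); rewrite /= ?mul1n ?mul0n ?addr0 ?add0r.
- move=> s c si ch; rewrite mxE; have cs : (c < s)%N by lia.
  rewrite cs /lower cs (_ : (s < i)%N = false); last by lia.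
  by rewrite -val_eqE gtn_eqF.
- rewrite mxE hi /lower hi ltnn eqxx ltnNge jh /=.
  by rewrite (_ : (h == h.+1 :> nat) = false) //; lia.
Qed.

Lemma eq_stage i j x i' j' x' : (forall s c, lower i j x s c = lower i' j' x' s c) ->
  stage i j x = stage i' j' x'.
Proof.
move=> eqL; apply/matrixP => s c; rewrite !mxE !eqL.
by congr (if _ then _ else if _ then _ else _ - _ - _)%N; apply: eq_bigr => k _; rewrite eqL.
Qed.

End Stages.

(** * The order on the triples *)

Section TripleOrder.
Variable N : nat.
Implicit Types t u : triple N.

Definition lexlt (i j h i' j' h' : nat) : bool :=
  [|| i < i', (i == i') && (j < j') | [&& i == i', j == j' & h' < h]]%N.

Lemma precedesE t u : precedes t u =
  lexlt (tr_i t) (tr_j t) (tr_h t) (tr_i u) (tr_j u) (tr_h u).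
Proof. by []. Qed.

Lemma precedes_irr : irreflexive (@precedes N).
Proof. by move=> t; rewrite /precedes !ltnn !andbF. Qed.

Lemma precedes_trans : transitive (@precedes N).
Proof.
move=> t1 t2 t3; rewrite !precedesE /lexlt; lia.
Qed.

Lemma triple_eqP t u : tr_i t = tr_i u -> tr_h t = tr_h u -> tr_j t = tr_j u -> t = u.
Proof.
move=> ei eh ej; apply: val_inj => /=; rewrite [LHS]surjective_pairing [RHS]surjective_pairing.
by rewrite [(tr_ihj t).1]surjective_pairing [(tr_ihj u).1]surjective_pairing; congr (_, _, _).
Qed.

Lemma precedes_total t u : [|| t == u, precedes t u | precedes u t].
Proof.
case: eqVneq => //= tu; rewrite !precedesE /lexlt.
have : ~ (tr_i t = tr_i u /\ tr_h t = tr_h u /\ tr_j t = tr_j u).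
  by move=> [ei [eh ej]]; move/eqP: tu; apply; apply: triple_eqP.
move=> ne; have : ~ (tr_i t = tr_i u :> nat /\ tr_h t = tr_h u :> nat /\ tr_j t = tr_j u :> nat).
  by move=> [ei [eh ej]]; apply: ne; split; [|split]; apply: val_inj.
lia.
Qed.

Lemma triples_sorted : sorted (@precedes N) (triples N).
Proof.
have tot : total (fun t u : triple N => (t == u) || precedes t u).
  by move=> t u; have := precedes_total t u; rewrite [u == t]eq_sym; case: (t == u).
have tr : transitive (fun t u : triple N => (t == u) || precedes t u).
  move=> t1 t2 t3 /orP[/eqP ->//|p21] /orP[/eqP <-|p13]; first by rewrite p21 orbT.
  by rewrite (precedes_trans p21 p13) orbT.
have := sort_sorted tot (enum {: triple N}); rewrite -/(triples N).
have : uniq (triples N) by rewrite sort_uniq enum_uniq.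
case: (triples N) => //= t s.
elim: s t => //= u s IHs t /andP[tus us] /andP[tu_le us_le].
rewrite (IHs u us us_le) andbT; case/orP: tu_le => // /eqP tu.
by rewrite tu mem_head in tus.
Qed.

Lemma mem_triples t : t \in triples N.
Proof. by rewrite mem_sort mem_enum. Qed.

Definition next_triple t t' : bool :=
  precedes t t' && [forall u, precedes t u ==> (u == t') || precedes t' u].

(** In a sorted list of all triples, neighbours are covering pairs. Triples before t are allowed to
    be missing so that the induction can drop the head. *)
Lemma path_next_triple t s : path (@precedes N) t s ->
    (forall u, u \in t :: s \/ precedes u t) ->
  path next_triple t s.
Proof.
elim: s t => //= t' s IHs t /andP[tt' t's] cover; apply/andP; split.
  rewrite /next_triple tt' /=; apply/forallP => u; apply/implyP => tu.
  case: (cover u) => [|ut]; last by have := precedes_trans tu ut; rewrite precedes_irr.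
  rewrite !inE => /or3P[/eqP ut|->//|us].
    by rewrite ut precedes_irr in tu.
  by rewrite (allP (order_path_min precedes_trans t's)) ?orbT.
apply: IHs => // u; case: (cover u) => [|ut]; last by right; exact: precedes_trans tt'.
by rewrite inE => /orP[/eqP ->|]; [right|left].
Qed.

Lemma next_tripleP t t' : next_triple t t' ->
  [\/ [/\ tr_i t' = tr_i t, tr_j t' = tr_j t & tr_h t = (tr_h t').+1 :> nat],
      [/\ tr_i t' = tr_i t, tr_j t' = (tr_j t).+1 :> nat, tr_h t = tr_j t
        & (tr_h t').+1 = tr_i t :> nat]
    | [/\ tr_h t = tr_j t, tr_i t = (tr_j t).+1 :> nat, tr_i t' = (tr_i t).+1 :> nat,
          tr_j t' = 0%N :> nat & tr_h t' = tr_i t :> nat]].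
Proof.
case/andP=> tt' /forallP next.
have lt_t : (tr_j t <= tr_h t < tr_i t)%N := tripleP t.
have lt_t' : (tr_j t' <= tr_h t' < tr_i t')%N := tripleP t'.
have iN := ltn_ord (tr_i t'); have iN0 := ltn_ord (tr_i t).
(* Any admissible triple after t is t' or comes after t'. Applied to the expected successor in each
   case, this leaves only t'. *)
have step (i h j : nat) : (j <= h < i)%N -> (i < N)%N ->
      lexlt (tr_i t) (tr_j t) (tr_h t) i j h ->
    [\/ [/\ i = tr_i t' :> nat, h = tr_h t' :> nat & j = tr_j t' :> nat]
      | lexlt (tr_i t') (tr_j t') (tr_h t') i j h].
  move=> /andP[jh hi] iN'; have hN := ltn_trans hi iN'; have jN := leq_ltn_trans jh hN.
  have P : (Ordinal jN <= Ordinal hN < Ordinal iN')%N by rewrite /= jh.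
  have := next (Triple (tr_ihj := (Ordinal iN', Ordinal hN, Ordinal jN)) P).
  rewrite !precedesE => /implyP imp /imp /orP[/eqP <-|]; by [left|right].
move: tt'; rewrite precedesE /lexlt => tt'.
have val3 (a b : 'I_N) : a = b :> nat -> a = b by exact: val_inj.
case: (ltnP (tr_j t) (tr_h t)) => jh.
  have := step (tr_i t) (tr_h t).-1 (tr_j t); rewrite /lexlt => st.
  case: st; [lia|lia|lia|move=> [ei eh ej]|lia].
  by constructor 1; split; try apply: val3; lia.
case: (ltnP (tr_j t).+1 (tr_i t)) => ji.
  have := step (tr_i t) (tr_i t).-1 (tr_j t).+1; rewrite /lexlt => st.
  case: st; [lia|lia|lia|move=> [ei eh ej]|lia].
  by constructor 2; split; try apply: val3; lia.
have := step (tr_i t).+1 (tr_i t) 0%N; rewrite /lexlt => st.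
case: st; [lia|lia|lia|move=> [ei eh ej]|lia].
by constructor 3; split; try apply: val3; lia.
Qed.

Lemma card_triple : #|{: triple N}| = (\sum_(i < N) \sum_(h < N | h < i) h.+1)%N.
Proof.
rewrite card_sub -sum1_card /=.
rewrite -(pair_big_dep xpredT (fun (ih : 'I_N * 'I_N) (j : 'I_N) => (j <= ih.2 < ih.1)%N)
  (fun _ _ => 1%N)) /=.
rewrite -(pair_big xpredT xpredT
  (fun i h : 'I_N => \sum_(j < N | (j <= h < i)%N) 1)%N) /=.
apply: eq_bigr => i _; rewrite [RHS]big_mkcond; apply: eq_bigr => h _.
case: (ltnP h i) => hi; last by rewrite big_pred0 // => j; rewrite andbF.
rewrite (eq_bigl (fun j : 'I_N => (j < h.+1)%N)); last by move=> j; rewrite andbT.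
rewrite -(big_ord_widen _ (fun=> 1%N)) ?sum1_card ?card_ord //.
Qed.

(** A pair h < i admits h+1 values of j; summing gives triangular and then tetrahedral numbers. *)
Lemma size_triples : size (triples N) = ((N * (N ^ 2 - 1)) %/ 6)%N.
Proof.
rewrite size_sort -cardE card_triple.
have tri m : (2 * (\sum_(h < m) h.+1) = m * m.+1)%N.
  by elim: m => [|m IHm]; [rewrite big_ord0|rewrite big_ord_recr /= mulnDr IHm; lia].
have tet m : (6 * (\sum_(i < m) \sum_(h < i) h.+1) = m * (m ^ 2 - 1))%N.
  elim: m => [|m IHm]; first by rewrite big_ord0.
  rewrite big_ord_recr /= mulnDr IHm (_ : 6 = 3 * 2)%N // -mulnA tri.
  by case: m {IHm} => [|m] //; rewrite -!mulnn; nia.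
rewrite -tet mulKn //; apply: eq_bigr => i _.
by rewrite (big_ord_widen N (fun h => h.+1)) // ltnW.
Qed.

End TripleOrder.

(** * Structure constants and leading terms *)

Lemma uniq_odd_primes m :
  exists s : seq nat, [/\ uniq s, size s = m & all (fun p => prime p && odd p) s].
Proof.
elim: m => [|m [s [us <- ps]]]; first by exists [::].
have [p p_gt pr_p] := prime_above (maxn 2 (\max_(q <- s) q)).
move: p_gt; rewrite gtn_max => /andP[p2 ps_lt].
exists (p :: s); split=> //=; last first.
  by rewrite pr_p ps andbT; case: (even_prime pr_p) p2 => [->|].
rewrite us andbT; apply: contraL ps_lt => sp; rewrite -leqNgt.
by rewrite (big_rem p sp) /= leq_maxl.
Qed.

(** A nonzero polynomial has fewer roots than its size, while there are arbitrarily many odd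
    primes. *)
Lemma nonroot_odd_prime (g : {poly int}) : g != 0 ->
  exists p : nat, [/\ prime p, odd p & g.[p%:Z] != 0].
Proof.
move=> g0; have [s [us sz ps]] := uniq_odd_primes (size g).
have [/allP roots|] := boolP (all (fun p : nat => root g p%:Z) s).
  have root_s : all (root g) [seq p%:Z | p <- s] by rewrite all_map; apply/allP.
  have uniq_s : uniq [seq p%:Z | p <- s] by rewrite map_inj_uniq // => x y [].
  by have := max_poly_roots g0 root_s uniq_s; rewrite size_map sz ltnn.
case/allPn=> p sp; rewrite /root => gp; exists p.
by have /andP[] := allP ps p sp.
Qed.

Section Hall.
Variables n d : nat.
Implicit Types X B Y : Xi n d.

(* Where no counting polynomial exists, [hall] has its default value 0. *)
Lemma hall_neq0 X B Y : hall X B Y != 0 ->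
  exists (F : finFieldType) (b : {symmetric 'rV[F]_(2 * d).+1})
    (V1 V V2 : {ffun 'I_(2 * n).+2 -> {vspace 'rV[F]_(2 * d).+1}}),
  [/\ nondegenerate b, [/\ isflag b V1, isflag b V & isflag b V2],
      relpos V1 V = X, relpos V V2 = B & relpos V1 V2 = Y].
Proof.
have [hallP|no_hall] := boolp.EM (exists g, is_hall X B Y g); last first.
  by rewrite /hall classical_sets.xgetPN ?eqxx // => g hg; apply: no_hall; exists g.
move=> /nonroot_odd_prime[p [pr_p odd_p gp]].
have cardF : #|'F_p| = p by exact: card_Fp.
have [b [V1 [V2 [nd f1 f2 rel12]]]] := realization 'F_p Y.
have := classical_sets.xgetPex 0 hallP; rewrite -/(hall X B Y) => hall_p.
have := hall_p 'F_p b V1 V2; rewrite cardF => /(_ odd_p nd f1 f2 rel12) gpE.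
have : mid_flags b X B V1 V2 != finset.set0.
  by rewrite -card_gt0 lt0n; apply: contraNneq gp => mid0; rewrite gpE mid0.
case/set0Pn=> V; rewrite inE => /and3P[fV /eqP rel1 /eqP rel2].
by exists 'F_p, b, V1, V, V2.
Qed.

(** The constant 1 is a counting polynomial, and the chosen one agrees with it at every odd prime,
    since flags in position Y exist over F_p. *)
Lemma hall_eq1 X B Y :
    (forall (F : finFieldType) (b : {symmetric 'rV[F]_(2 * d).+1})
       (V1 V2 : {ffun 'I_(2 * n).+2 -> {vspace 'rV[F]_(2 * d).+1}}),
       nondegenerate b -> isflag b V1 -> isflag b V2 -> relpos V1 V2 = Y ->
       #|mid_flags b X B V1 V2| = 1%N) ->
  hall X B Y = 1.
Proof.
move=> mid1.
have hall1 : is_hall X B Y 1.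
  by move=> F b V1 V2 _ nd f1 f2 rel12; rewrite hornerC mid1.
have hallP : is_hall X B Y (hall X B Y) := classical_sets.xgetI 0 hall1.
apply/eqP; rewrite -subr_eq0; apply/negPn/negP => /nonroot_odd_prime[p [pr_p odd_p]].
have cardF : #|'F_p| = p by exact: card_Fp.
have [b [V1 [V2 [nd f1 f2 rel12]]]] := realization 'F_p Y.
have := hallP 'F_p b V1 V2; rewrite cardF => /(_ odd_p nd f1 f2 rel12).
by rewrite mid1 // !hornerE => ->; rewrite subrr eqxx.
Qed.

Lemma Sj_mulE (f g : Sj n d) Y :
  Sj_mul f g Y = \sum_X \sum_B (f X : laurent) * g B * at_vsqr (hall X B Y).
Proof.
rewrite sum_ffunE; apply: eq_bigr => X _; rewrite sum_ffunE; apply: eq_bigr => B _.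
rewrite ffunE sum_ffunE (bigD1 Y) //= big1 ?addr0; last first.
  by move=> Z /negPf ZY; rewrite !ffunE eq_sym ZY scaler0.
by rewrite !ffunE eqxx; congr (_ * _); exact: mulr1.
Qed.

Lemma stdE B X : std B X = vinv ^+ dstd B * (X == B)%:R :> laurent.
Proof. by rewrite !ffunE. Qed.

Lemma Sj_mul_stdE (f : Sj n d) B Y :
  Sj_mul f (std B) Y = \sum_X (f X : laurent) * vinv ^+ dstd B * at_vsqr (hall X B Y).
Proof.
rewrite Sj_mulE; apply: eq_bigr => X _; rewrite (bigD1 B) //= big1 ?addr0.
  by rewrite stdE eqxx mulr1.
by move=> Z /negPf ZB; rewrite stdE ZB mulr0 mulr0 mul0r.
Qed.

(** Coefficients are taken on the basis e, so v^{-d_C} at C means that [C] occurs with coefficient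
    1. *)
Definition leading (f : Sj n d) (C : Xi n d) : Prop :=
  f C = vinv ^+ dstd C /\ (forall X, (f X : laurent) != 0 -> Xi_le X C).

Lemma Xi_le_refl X : Xi_le X X.
Proof. by apply/Xi_leP. Qed.

Lemma leading_std B : leading (std B) B.
Proof.
split=> [|X]; first by rewrite stdE eqxx mulr1.
rewrite stdE; case: (eqVneq X B) => [-> _|_]; first exact: Xi_le_refl.
by rewrite mulr0 eqxx.
Qed.

Lemma dstd_diag (D : 'M[nat]_((2 * n).+1)) : is_diag_mx D -> dstd D = 0%N.
Proof.
move=> /is_diag_mxP diagD; rewrite /dstd.
rewrite [X in (X + _ + _)%N]big1 ?add0n; last first.
  move=> i _; rewrite big1 // => k /andP[ki _]; rewrite big1 // => j _.
  rewrite big1 // => l jl; case: (eqVneq i j) => [ij|ij]; last by rewrite diagD.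
  by rewrite [D k l]diagD ?muln0 //; apply/eqP => kl; subst; lia.
rewrite [X in (X + _)%N]big1 ?add0n; last first.
  move=> i _; rewrite big1 // => j _; rewrite big1 // => l /andP[jl _].
  case: (eqVneq i j) => [ij|ij]; last by rewrite diagD.
  by rewrite [D i l]diagD ?muln0 //; apply/eqP => il; subst; lia.
rewrite big1 // => i ni; rewrite big1 // => j jn.
by rewrite diagD //; apply/eqP => ij; subst; lia.
Qed.

(** A nonzero term at Y comes from flags in positions X, B and Y with X in the support of f;
    [Xi_le_raised] puts Y below C' and leaves only X = C when Y = C'. The degrees add because
    [raising_dstd] gives the same increment for (C, C') and (D, B), and D has degree 0. *)
Lemma leading_mul (f : Sj n d) (C C' B : Xi n d) (D : 'M[nat]_((2 * n).+1))
    (i h h1 : 'I_(2 * n).+1) r :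
    raising C C' i h r -> is_diag_mx D -> co D = co C -> raising D B h1 h r ->
    h1 = h.+1 :> nat ->
    rot_sym C -> rot_sym C' -> rot_sym D -> rot_sym B ->
    leading f C -> leading (Sj_mul f (std B)) C'.
Proof.
move=> rC diagD coD rD h1E symC symC' symD symB [fC supp_f].
have dC' : dstd C' = (dstd B + dstd C)%N.
  have := raising_dstd rC symC symC'; have := raising_dstd rD symD symB.
  rewrite (dstd_diag diagD).
  have pD t : (t <= (2 * n).+1)%N -> psum D (2 * n).+1 t = psum C (2 * n).+1 t.
    by move: t; apply/co_psum.
  have hi : (h < i)%N by case: rC.
  have iN := ltn_ord i.
  rewrite !pD; [lia|lia|lia].
have key X : (f X : laurent) != 0 -> hall X B C' != 0 -> X = C.
  move=> /supp_f XC /hall_neq0[F [b [V1 [V [V2 [nd [f1 fV f2] relX relB relY]]]]]].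
  have rV := raised_of_relpos nd fV f2 diagD rD h1E relB.
  have := @Xi_le_raised n d F b nd V1 V V2 C C' i h r f1 fV f2 rV rC symC symC'.
  by rewrite relX relY => /(_ XC)[_ /(_ erefl)] /val_inj.
split.
  rewrite Sj_mul_stdE (bigD1 C) //= big1 ?addr0.
    rewrite hall_eq1; last first.
      move=> F b V1 V2 nd f1 f2 rel12.
      exact: (card_mid_flags nd f1 f2 rel12 rC diagD coD rD h1E symC).
    by rewrite /at_vsqr rmorph1 hornerC mulr1 fC -exprD dC' addnC.
  move=> X XC; case: (eqVneq (f X : laurent) 0) => [->|fX]; first by rewrite !mul0r.
  case: (eqVneq (hall X B C') 0) => [->|hX]; last by rewrite (key X) ?eqxx in XC.
  by rewrite /at_vsqr rmorph0 horner0 mulr0.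
move=> Y; rewrite Sj_mul_stdE => neq0.
have [X [fX hX]] : exists X, (f X : laurent) != 0 /\ hall X B Y != 0.
  apply: boolp.contrapT => no; move/eqP: neq0; apply; apply: big1 => X _.
  case: (eqVneq (f X : laurent) 0) => [->|fX]; first by rewrite !mul0r.
  case: (eqVneq (hall X B Y) 0) => [->|hX]; last by case: no; exists X.
  by rewrite /at_vsqr rmorph0 horner0 mulr0.
have [F [b [V1 [V [V2 [nd [f1 fV f2] relX relB relY]]]]]] := hall_neq0 hX.
have rV := raised_of_relpos nd fV f2 diagD rD h1E relB.
have := @Xi_le_raised n d F b nd V1 V V2 C C' i h r f1 fV f2 rV rC symC symC'.
by rewrite relX relY => /(_ (supp_f X fX))[].
Qed.

Lemma vinvV : (v : laurent) * vinv = 1.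
Proof. by apply: val_inj; rewrite /= mulfV // tofrac_eq0 polyX_eq0. Qed.

Lemma leading_expansion (f : Sj n d) (A : Xi n d) : leading f A ->
  exists c : Xi n d -> laurent,
    f = std A + \sum_(A' : Xi n d | Xi_lt A' A) c A' *: std A'.
Proof.
(* The change of basis e_X = v^{d_X} [X]. *)
move=> [fA supp]; exists (fun X => (f X : laurent) * v ^+ dstd X).
apply/ffunP => Y; rewrite ffunE stdE sum_ffunE.
case: (eqVneq Y A) => [->|YA].
  rewrite mulr1 fA big1 ?addr0 // => X /andP[_ XA]; rewrite ffunE stdE.
  case: (eqVneq A X) => [AX|_]; last by rewrite mulr0 scaler0.
  by rewrite AX eqxx in XA.
rewrite mulr0 add0r; case: (boolP (Xi_lt Y A)) => YlA.
  rewrite (bigD1 Y) //= big1 ?addr0; last first.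
    by move=> X /andP[_ /negPf XY]; rewrite ffunE stdE eq_sym XY mulr0 scaler0.
  rewrite ffunE stdE eqxx mulr1 -[_ *: _]mulrA -exprMn vinvV expr1n mulr1 //.
rewrite big1; last first.
  move=> X XlA; rewrite ffunE stdE; case: (eqVneq Y X) => [YX|_]; last by rewrite mulr0 scaler0.
  by rewrite YX XlA in YlA.
apply/eqP/negPn/negP => /supp YlA'; move: YlA; rewrite /Xi_lt YlA' /= negbK.
by move=> /eqP/val_inj YA'; rewrite YA' eqxx in YA.
Qed.

End Hall.

(** * The factors *)

Section Factorization.
Variables (n d : nat) (A : Xi n d).
Notation N := (2 * n).+1.
Implicit Types t : triple N.

Lemma tr_jh t : (tr_j t <= tr_h t)%N. Proof. by have /andP[] := tripleP t. Qed.
Lemma tr_hi t : (tr_h t < tr_i t)%N. Proof. by have /andP[] := tripleP t. Qed.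

Definition before t : Xi n d := stageXi A (tr_i t) (leqW (tr_jh t)).
Definition after t : Xi n d := stageXi A (tr_i t) (tr_jh t).

Lemma raising_triple t :
  raising (before t) (after t) (tr_i t) (tr_h t) (A (tr_i t) (tr_j t)).
Proof. exact: raising_stage (tr_jh t) (tr_hi t). Qed.

Definition tr_h1 t : 'I_N := inord (tr_h t).+1.

Lemma tr_h1E t : tr_h1 t = (tr_h t).+1 :> nat.
Proof. by rewrite inordK //; exact: leq_ltn_trans (tr_hi t) (ltn_ord _). Qed.

(** The factor is obtained from this matrix by moving a_{ij} units from (h+1, h+1) to (h+1, h), so
    the diagonal part of the factor is what remains after removing them. *)
Definition codiag t : 'M[nat]_N := diag_mx (co (before t)).

Definition diag_part t : 'M[nat]_N := \matrix_(s, c)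
  (codiag t s c - (Etheta (tr_h1 t) (tr_h1 t) *+ A (tr_i t) (tr_j t)) s c)%N.

Definition factor_mx t := factor A (diag_part t) t.

Lemma codiagE t s c : codiag t s c = (co (before t) 0%R s * (s == c))%N.
Proof. by rewrite mxE; case: (s == c); rewrite ?muln1 ?muln0 ?mulr1n ?mulr0n. Qed.

Lemma co_codiag t : co (codiag t) = co (before t).
Proof.
apply/rowP => c; rewrite mxE (bigD1 c) //= codiagE eqxx muln1 big1 ?addn0 //.
by move=> s sc; rewrite codiagE (negPf sc) muln0.
Qed.

Lemma ro_codiag t : ro (codiag t) = co (before t).
Proof.
apply/rowP => s; rewrite mxE (bigD1 s) //= codiagE eqxx muln1 big1 ?addn0 //.
by move=> c cs; rewrite codiagE eq_sym (negPf cs) muln0.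
Qed.

Lemma rot_sym_codiag t : rot_sym (codiag t).
Proof.
move=> s c; rewrite !codiagE (co_rot s (rot_sym_Xi (before t))).
by rewrite (inj_eq rev_ord_inj).
Qed.

(** The subtraction does not truncate: column h+1 loses these units when the leading matrix is
    raised, so its sum is large enough, also when h+1 is the middle index and twice a_{ij} is
    removed. *)
Lemma diag_part_eq t :
  diag_part t + Etheta (tr_h1 t) (tr_h1 t) *+ A (tr_i t) (tr_j t) = codiag t.
Proof.
set r := A _ _; have h1E := tr_h1E t; have hi := tr_hi t; have iN := ltn_ord (tr_i t).
apply/matrixP => s c; rewrite mxE [diag_part t s c]mxE; apply: subnK.
rewrite mulmx_natE codiagE EthetaE; case: (eqVneq s c) => [<-|sc]; last first.
  have -> : ((s == tr_h1 t) * (c == tr_h1 t) = 0)%N.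
    case: (eqVneq s (tr_h1 t)) => // sE; case: (eqVneq c (tr_h1 t)) => // cE.
    by rewrite sE cE eqxx in sc.
  have -> : ((s == rev_ord (tr_h1 t)) * (c == rev_ord (tr_h1 t)) = 0)%N.
    case: (eqVneq s (rev_ord (tr_h1 t))) => // sE.
    case: (eqVneq c (rev_ord (tr_h1 t))) => // cE.
    by rewrite sE cE eqxx in sc.
  by rewrite mul0n.
have /rowP/(_ s) := congr1 (@co N) (raising_eq (raising_triple t)).
rewrite !coD -/(tr_h1 t) -/r.
have addE (u w : 'rV[nat]_N) : (u + w) 0 s = (u 0%R s + w 0%R s)%N by rewrite mxE.
rewrite !addE !co_Etheta muln1.
case: (eqVneq s (tr_h1 t)) => [->|sh1]; case: (eqVneq _ (rev_ord (tr_h1 t))) => [sh1'|sh1'];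
  rewrite ?mul0n //.
- have -> : (tr_h1 t == tr_h t) = false by apply/eqP => /(congr1 val) /=; lia.
  have -> : (tr_h1 t == rev_ord (tr_h t)) = false.
    by apply/eqP => /(congr1 val) /=; lia.
  lia.
- have -> : (tr_h1 t == tr_h t) = false by apply/eqP => /(congr1 val) /=; lia.
  have -> : (tr_h1 t == rev_ord (tr_h t)) = false.
    by apply/eqP => /(congr1 val) /=; lia.
  lia.
rewrite sh1'; have -> : (rev_ord (tr_h1 t) == tr_h t) = false.
  by apply/eqP => /(congr1 val) /=; lia.
have -> : (rev_ord (tr_h1 t) == rev_ord (tr_h t)) = false.
  by apply/eqP => /rev_ord_inj /(congr1 val) /=; lia.
lia.
Qed.

Lemma raising_factor t :
  raising (codiag t) (factor_mx t) (tr_h1 t) (tr_h t) (A (tr_i t) (tr_j t)).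
Proof.
have h1E := tr_h1E t; split; first by rewrite h1E.
- by rewrite /factor_mx /factor -/(tr_h1 t) -diag_part_eq addrAC.
- move=> s c; rewrite h1E => hs ch; rewrite codiagE.
  by rewrite -val_eqE gtn_eqF ?muln0 //; exact: leq_ltn_trans ch hs.
- by rewrite codiagE -val_eqE /= h1E gtn_eqF ?muln0.
Qed.

Lemma is_diag_diag_part t : is_diag_mx (diag_part t).
Proof.
by apply/is_diag_mxP => s c sc; rewrite mxE codiagE -val_eqE (negPf sc) muln0.
Qed.

Lemma is_diag_codiag t : is_diag_mx (codiag t).
Proof. exact: diag_mx_is_diag. Qed.

Lemma rot_sym_factor t : rot_sym (factor_mx t).
Proof.
apply: rot_symD; last exact/rot_symMn/rot_sym_Etheta.
move=> s c; rewrite [LHS]mxE [RHS]mxE rot_sym_codiag; congr (_ - _)%N.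
exact: (rot_symMn _ (rot_sym_Etheta _ _)).
Qed.

Lemma factor_Xi_proof t : Xi_pred d (factor_mx t).
Proof.
apply: Xi_predE; first exact: rot_sym_factor.
have := raising_psum (raising_factor t) (leqnn N) (leqnn N).
have /co_psum -> // := co_codiag t; rewrite psum_Xi.
have := tr_hi t; have := ltn_ord (tr_i t); have := tr_h1E t; lia.
Qed.

Definition factorXi t : Xi n d := MkXi (factor_Xi_proof t).

Lemma ro_factor t : ro (factorXi t) = co (before t).
Proof.
rewrite -ro_codiag; apply/ro_psum => s sN.
have := raising_psum (raising_factor t) sN (leqnn N).
have := tr_hi t; have := ltn_ord (tr_i t); have := tr_h1E t; rewrite /=; lia.
Qed.

Lemma co_factor t : co (factorXi t) = co (after t).
Proof.
apply/co_psum => u uN.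
have := raising_psum (raising_factor t) (leqnn N) uN.
have := raising_psum (raising_triple t) (leqnn N) uN.
have /co_psum -> // := co_codiag t.
have := ltn_ord (tr_i t); have := ltn_ord (tr_h1 t); rewrite /=; lia.
Qed.

Lemma leading_step t (f : Sj n d) : leading f (before t) ->
  leading (Sj_mul f (std (factorXi t))) (after t).
Proof.
apply: (@leading_mul n d f _ _ (factorXi t) _ _ _ _ _ (raising_triple t)
  (is_diag_codiag t) (co_codiag t) (raising_factor t) (tr_h1E t));
  try exact: rot_sym_Xi.
exact: rot_sym_codiag.
Qed.

(** Once a_{ij} has reached column j, the next entry to be treated still sits on the diagonal: there
    h'+1 = i', and [lower] has no entry in that column of row i'. *)
Lemma after_next t t' : next_triple t t' -> after t = before t'.
Proof.
move=> /next_tripleP nx; apply: val_inj; apply: eq_stage => s c; rewrite /lower.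
case: ltnP => // cs; case: nx => [[-> -> ->]//|[-> j' hj hi]|[hj ij i' j' h']].
  rewrite hj hi j'; case: (ltngtP s (tr_i t)) => // [|/val_inj si].
    by move=> lt; rewrite -val_eqE gtn_eqF.
  rewrite si eqxx ltnS; case: (ltngtP c (tr_j t)) => // [_|/val_inj ->] //.
  by rewrite -si ltn_eqF.
rewrite -[s == tr_i t']val_eqE /= i' h' j' hj ltnS ltn0.
case: (ltngtP s (tr_i t)) => [//|lt|/val_inj si].
  rewrite -val_eqE gtn_eqF //; case: eqP => // si.
  by case: eqP => // ci; lia.
rewrite si eqxx; case: (ltngtP c (tr_j t)) => // [lt|/val_inj -> //].
by move: cs; rewrite si; lia.
Qed.

End Factorization.

(** * The chain of factors and its product *)

Lemma path_le_last (T : eqType) (r : rel T) x s y : transitive r -> path r x s ->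
  y \in x :: s -> (y == last x s) || r y (last x s).
Proof.
move=> tr_r; elim: s x y => [|z s IHs] x y /=; first by rewrite inE => _ ->.
move=> /andP[xz zs]; rewrite inE => /orP[/eqP ->|]; last exact: IHs.
case/orP: (IHs z z zs (mem_head _ _)) => [/eqP <-|zl]; first by rewrite xz orbT.
by rewrite (tr_r _ _ _ xz zl) orbT.
Qed.

Section Assembly.
Variables (n d : nat) (A : Xi n d).
Notation N := (2 * n).+1.
Implicit Types t : triple N.

Lemma diag_eq_of_ro (D1 D2 : 'M[nat]_N) :
  is_diag_mx D1 -> is_diag_mx D2 -> ro D1 = ro D2 -> D1 = D2.
Proof.
have roE (D : 'M[nat]_N) i : is_diag_mx D -> ro D 0 i = D i i.
  move=> /is_diag_mxP diagD; rewrite mxE (bigD1 i) //= big1 ?addn0 // => j ji.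
  by rewrite diagD // eq_sym.
move=> d1 d2 eqr; apply/matrixP => i j; case: (eqVneq i j) => [<-|ij].
  by rewrite -!roE // eqr.
have /is_diag_mxP -> // := d1; by have /is_diag_mxP -> := d2.
Qed.

Lemma factor_uniq t (D B : 'M[nat]_N) : is_diag_mx D -> B = factor A D t ->
  ro B = ro (factorXi A t) -> D = diag_part A t /\ B = factorXi A t.
Proof.
move=> diagD -> eqr; suff DE : D = diag_part A t by rewrite DE.
apply: diag_eq_of_ro => //; first exact: is_diag_diag_part.
apply/rowP => i; have /rowP/(_ i) := eqr; rewrite !roD.
have addE (u w : 'rV[nat]_N) : (u + w) 0 i = (u 0%R i + w 0%R i)%N by rewrite mxE.
by rewrite !addE => /addIn.
Qed.

Lemma leading_path s t (f : Sj n d) : leading f (after A t) ->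
    path (@next_triple N) t s ->
  leading (foldl (@Sj_mul n d) f [seq std (factorXi A u) | u <- s]) (after A (last t s)).
Proof.
elim: s t f => [|t' s IHs] t f lead; first by move=> _.
case/andP=> tt' t's.
have lead' : leading (Sj_mul f (std (factorXi A t'))) (after A t').
  by apply: leading_step; rewrite -(after_next A tt').
exact: (IHs t' _ lead' t's).
Qed.

Lemma chain_path s t : path (@next_triple N) t s ->
  path (fun M M' : 'M[nat]_N => co M == ro M') (factorXi A t)
    [seq (factorXi A u : 'M[nat]_N) | u <- s].
Proof.
elim: s t => //= t' s IHs t /andP[tt' t's]; rewrite IHs // andbT.
by rewrite co_factor ro_factor (after_next A tt').
Qed.

(** Row sums determine a diagonal matrix, so each factor is fixed by its row sums, and its column
    sums hand them on to the next one. *)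
Lemma factor_uniq_path s t (D' : triple N -> 'M[nat]_N) (B' : triple N -> Xi n d) :
    path (@next_triple N) t s ->
    (forall u, is_diag_mx (D' u)) -> (forall u, B' u = factor A (D' u) u :> 'M[nat]_N) ->
    path (fun M M' : 'M[nat]_N => co M == ro M') (B' t) [seq (B' u : 'M[nat]_N) | u <- s] ->
    ro (B' t) = ro (factorXi A t) ->
  forall u, u \in t :: s -> D' u = diag_part A u.
Proof.
move=> + diagD BE; elim: s t => [|t' s IHs] t /=.
  by move=> _ _ eqr u; rewrite inE => /eqP ->; have [] := factor_uniq (diagD t) (BE t) eqr.
move=> /andP[tt' t's] /andP[/eqP chain chain'] eqr u.
have [Dt Bt] := factor_uniq (diagD t) (BE t) eqr.
rewrite inE => /orP[/eqP -> //|]; apply: IHs => //.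
by rewrite -chain Bt co_factor ro_factor (after_next A tt').
Qed.

Lemma before_first t : tr_i t = 1%N :> nat -> tr_h t = 0%N :> nat ->
  before A t = codiag A t :> 'M[nat]_N.
Proof.
move=> i1 h0; have j0 : tr_j t = 0%N :> nat by have := tr_jh t; rewrite h0; lia.
have low s c : lower A (tr_i t) (tr_j t) (tr_h t).+1 s c = 0%N.
  rewrite /lower; case: ltnP => // cs; case: ltnP => si; first by lia.
  case: eqP => // sE; rewrite j0 ltn0; case: eqP => // cE; move: cs; rewrite sE; lia.
have dg : is_diag_mx (before A t : 'M[nat]_N).
  apply/is_diag_mxP => s c sc; rewrite mxE !low.
  by case: ltngtP sc.
apply: diag_eq_of_ro => //; first exact: is_diag_codiag.
rewrite ro_codiag; apply/rowP => s; rewrite !mxE (bigD1 s) // [RHS](bigD1 s) //=.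
have /is_diag_mxP diagM := dg.
rewrite big1 => [|c cs]; last by rewrite diagM // eq_sym.
by rewrite big1 // => c cs; rewrite diagM.
Qed.

(** Nothing lies below the diagonal before the first triple, so the factor and the leading matrix
    arise from the same diagonal matrix by the same move. The induction can thus start at the first
    factor itself. *)
Lemma factor_first t : tr_i t = 1%N :> nat -> tr_h t = 0%N :> nat ->
  factorXi A t = after A t.
Proof.
move=> i1 h0; have bE := before_first i1 h0.
have i_h1 : tr_h1 t = tr_i t by apply: val_inj; rewrite /= tr_h1E i1 h0.
have := raising_eq (raising_triple A t); have := raising_eq (raising_factor A t).
rewrite bE i_h1 => <- /matrixP eqM; apply: val_inj; apply/matrixP => s c.
have := eqM s c; rewrite [LHS]mxE [RHS]mxE.
by move=> /addIn ->.
Qed.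

Lemma after_last t : tr_i t = (2 * n)%N :> nat -> (tr_j t).+1 = tr_i t :> nat ->
  after A t = A.
Proof.
move=> iN ji; have hj : tr_h t = tr_j t :> nat.
  by have := tr_jh t; have := tr_hi t; lia.
apply: val_inj; apply: eq_of_lower; try exact: rot_sym_Xi.
  exact: (ro_stage A (tr_i t) (tr_jh t)).
move=> s c cs; rewrite mxE cs /lower cs; have sN := ltn_ord s.
case: (ltngtP s (tr_i t)) => [//|lt|/val_inj si]; first by lia.
rewrite si eqxx hj; case: (ltngtP c (tr_j t)) => // [lt|/val_inj -> //].
by move: cs; rewrite si; lia.
Qed.

End Assembly.

Theorem theorem3p10 (n d : nat) (hn : (1 <= n)%N) (hd : (1 <= d)%N)
    (A : Xi n d) :
  let N := (2 * n).+1 in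
  (exists (D : {ffun triple N -> 'M[nat]_N}) (B : triple N -> Xi n d),
     [/\ factorization A D B,
         (forall (D' : {ffun triple N -> 'M[nat]_N}) (B' : triple N -> Xi n d),
            factorization A D' B' -> D' = D)
       & exists c : Xi n d -> laurent,
           Sj_prod [seq std (B t) | t <- triples N] =
           std A + \sum_(A' : Xi n d | Xi_lt A' A) c A' *: std A'])
  /\ size (triples N) = ((N * (N ^ 2 - 1)) %/ 6)%N.
Proof.
move=> N; subst N; split; last exact: size_triples.
have i1 : (1 < (2 * n).+1)%N by lia.
have j0 : (0 < (2 * n).+1)%N by [].
have iN : (2 * n < (2 * n).+1)%N by [].
have jN : ((2 * n).-1 < (2 * n).+1)%N by lia.
have P0 : (Ordinal j0 <= Ordinal j0 < Ordinal i1)%N by [].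
have PN : (Ordinal jN <= Ordinal jN < Ordinal iN)%N by rewrite /= leqnn; lia.
pose u0 : triple (2 * n).+1 := Triple (tr_ihj := (Ordinal i1, Ordinal j0, Ordinal j0)) P0.
pose uN : triple (2 * n).+1 := Triple (tr_ihj := (Ordinal iN, Ordinal jN, Ordinal jN)) PN.
have mem := @mem_triples (2 * n).+1; have := triples_sorted (2 * n).+1; rewrite /factorization.
case: (triples (2 * n).+1) mem => [|t0 s] mem; first by have := mem u0.
move=> /= sorted_s.
have next_s : path (@next_triple (2 * n).+1) t0 s.
  by apply: path_next_triple => // u; left.
(* No triple precedes [u0], so it is the head of the sorted list; likewise [uN] is its last
   element. *)
have [t0i t0h] : tr_i t0 = 1%N :> nat /\ tr_h t0 = 0%N :> nat.
  have := mem u0; rewrite inE => /orP[/eqP <- //|u0s].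
  have := allP (order_path_min (@precedes_trans (2 * n).+1) sorted_s) u0 u0s.
  have [ei eh ej] : [/\ tr_i u0 = 1 :> nat, tr_h u0 = 0 :> nat & tr_j u0 = 0 :> nat]%N by [].
  rewrite precedesE /lexlt ei eh ?ej; have := tr_jh t0; have := tr_hi t0; lia.
have [tNi tNj] : tr_i (last t0 s) = (2 * n)%N :> nat /\
    (tr_j (last t0 s)).+1 = tr_i (last t0 s) :> nat.
  case/orP: (path_le_last (@precedes_trans (2 * n).+1) sorted_s (mem uN)) => [/eqP <- /=|].
    by split=> //; lia.
  set t := last t0 s.
  have [ei eh ej] : [/\ tr_i uN = 2 * n :> nat, tr_h uN = (2 * n).-1 :> nat
    & tr_j uN = (2 * n).-1 :> nat]%N by [].
  rewrite precedesE /lexlt ei eh ?ej.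
  have := tr_jh t; have := tr_hi t; have := ltn_ord (tr_i t); lia.
have ro0 : ro (factorXi A t0) = ro A.
  rewrite (factor_first A t0i t0h); exact: (ro_stage A (tr_i t0) (tr_jh t0)).
exists [ffun t => diag_part A t], (factorXi A); split.
- split=> [t|t|||].
  + by rewrite ffunE is_diag_diag_part.
  + by rewrite ffunE.
  + exact: chain_path.
  + by rewrite ro0.
  + rewrite -map_comp -[_ :: _]/(map (fun t => co (factorXi A t)) (t0 :: s)).
    rewrite -map_rev lastI rev_rcons /=.
    by rewrite co_factor (after_last A tNi tNj).
- move=> D' B' [diagD BE chain [ro0'] _]; apply/ffunP => t; rewrite ffunE.
  apply: (factor_uniq_path next_s diagD BE chain) => //.
  by rewrite ro0' ro0.
- have lead0 : leading (std (factorXi A t0)) (after A t0).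
    by rewrite -(factor_first A t0i t0h); exact: leading_std.
  have := leading_path lead0 next_s; rewrite (after_last A tNi tNj).
  exact: leading_expansion.
Qed.
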